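(* Let $\mathbf{L}\in Q(\mathbb{B}^n)\cap K(\mathbb{B}^n)$ with $\beta>c\sqrt n$, where $c\ge1$ is the constant in the definition of $K(\mathbb{B}^n)$ for $\mathbf{L}$. If an analytic function $F:\mathbb{B}^n\to\mathbb{C}$ has bounded $\mathbf{L}$-index in joint variables, then $$\ln M(F,R)=O\left(\min_{\sigma_n\in\mathcal{S}_n}\ \min_{\Theta\in[0,2\pi]^n}\ \sum_{j=1}^n\int_0^{r_j}l_j\left(R(j,\sigma_n,t)e^{i\Theta}\right)dt\right)\quad\text{as }|R|\to1-0,$$ where $R=(r_1,\dots,r_n)$, $\sigma_n$ is a permutation of $\{1,\dots,n\}$, $\mathcal{S}_n$ is the set of all permutations of $\{1,\dots,n\}$, $R^0=(r^0_1,\dots,r^0_n)$ is a fixed radius, and $R(j,\sigma_n,t)=(r'_1,\dots,r'_n)$ with $$r'_k=\begin{cases}r^0_k,&\text{if }\sigma_n(k)<\sigma_n(j),\\ t,&\text{if }k=j,\\ r_k,&\text{if }\sigma_n(k)>\sigma_n(j),\end{cases}\qquad k\in\{1,\dots,n\}.$$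
   Context: $\mathbb{R}_+=[0,+\infty)$, $\mathbb{Z}_+=\{0,1,2,\dots\}$. $|\cdot|$ is the Euclidean norm on $\mathbb{C}^n$ (and on $\mathbb{R}^n$); $\mathbb{B}^n=\{z\in\mathbb{C}^n:|z|<1\}$. For $K\in\mathbb{Z}^n_+$: $\|K\|=k_1+\dots+k_n$, $K!=k_1!\cdots k_n!$, $A^K=a_1^{k_1}\cdots a_n^{k_n}$, and $F^{(K)}=\partial^{\|K\|}F/\partial z_1^{k_1}\cdots\partial z_n^{k_n}$. Quotients of vectors are componentwise. For $R=(r_1,\dots,r_n)\in\mathbb{R}^n_+$, $\Theta=(\theta_1,\dots,\theta_n)\in[0,2\pi]^n$: $Re^{i\Theta}=(r_1e^{i\theta_1},\dots,r_ne^{i\theta_n})$. $\mathbb{D}^n[z^0,R]=\{z:|z_j-z^0_j|\le r_j,\ j=1,\dots,n\}$. For $|R|<1$, $M(F,R)=\max\{|F(z)|:|z_j|=r_j,\ j=1,\dots,n\}$. Fix a constant $\beta>\sqrt n$. $Q(\mathbb{B}^n)$ is the class of $\mathbf{L}=(l_1,\dots,l_n)$ with each $l_j:\mathbb{B}^n\to\mathbb{R}_+$ continuous, $l_j(z)>\beta/(1-|z|)$ for all $z\in\mathbb{B}^n$, and, for all $R\in\mathbb{R}^n_+$ with $|R|\le\beta$ and all $j$, $0<\lambda_{1,j}(R)\le\lambda_{2,j}(R)<\infty$, where $\lambda_{1,j}(R)$ and $\lambda_{2,j}(R)$ are respectively the infimum and the supremum of $l_j(z)/l_j(z^0)$ over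 all $z^0\in\mathbb{B}^n$ and $z\in\mathbb{D}^n[z^0,R/\mathbf{L}(z^0)]$. $K(\mathbb{B}^n)$ is the class of positive continuous $\mathbf{L}=(l_1,\dots,l_n)$ on $\mathbb{B}^n$ with $l_j(z)>\beta/(1-|z|)$ for all $z\in\mathbb{B}^n$ and all $j$, for which there is $c\ge1$ such that for every $R\in\mathbb{R}^n_+$ with $|R|<1$ and every $j\in\{1,\dots,n\}$: $\max_{\Theta_1,\Theta_2\in[0,2\pi]^n}\frac{l_j(Re^{i\Theta_2})}{l_j(Re^{i\Theta_1})}\le c$. An analytic $F:\mathbb{B}^n\to\mathbb{C}$ is of bounded $\mathbf{L}$-index in joint variables if there is $m\in\mathbb{Z}_+$ such that for all $z\in\mathbb{B}^n$ and $J\in\mathbb{Z}^n_+$: $\frac{|F^{(J)}(z)|}{J!\mathbf{L}^J(z)}\le\max\{\frac{|F^{(K)}(z)|}{K!\mathbf{L}^K(z)}:K\in\mathbb{Z}^n_+,\|K\|\le m\}$. *)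

(* Defs.v *)
From HB Require Import structures.
From mathcomp Require Import all_boot all_order all_algebra all_fingroup finmap.
From mathcomp Require Import all_classical all_reals all_analysis.
From mathcomp Require Import complex.
From mathcomp Require Import analysis.showcase.summability.

Set Implicit Arguments.
Unset Strict Implicit.
Unset Printing Implicit Defensive.

Import Order.TTheory GRing.Theory Num.Theory.
Import numFieldNormedType.Exports.

Local Open Scope classical_set_scope.
Local Open Scope ring_scope.
Local Open Scope complex_scope.

(* R[i] as a numFieldType: R[i] itself carries no topology, but the carrier of
   a numFieldType has the one induced by its norm, and so do the spaces of row
   vectors over it.  The canonical instance is named explicitly because the
   equivalent [the numFieldType of R[i]] and R[i]^o make unification diverge. *)
Notation Cplx R :=
  (Num.NumField.sort (ComplexField.complex_complex__canonical__Num_NumField R)).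

Definition cabs (R : realType) (z : Cplx R) : R := ComplexField.Normc.normc z.

Definition rnorm (R : realType) (n : nat) (x : 'rV[R]_n) : R :=
  Num.sqrt (\sum_j x ord0 j ^+ 2).

Definition cnorm (R : realType) (n : nat) (z : 'rV[Cplx R]_n) : R :=
  Num.sqrt (\sum_j cabs (z ord0 j) ^+ 2).

(* The Euclidean ball; the library's [ball] on 'rV is for the sup norm. *)
Definition unit_ball (R : realType) (n : nat) : set 'rV[Cplx R]_n :=
  [set z | cnorm z < 1].

Definition nonneg_vec (R : realType) (n : nat) : set 'rV[R]_n :=
  [set r | forall j, 0 <= r ord0 j].

Definition angles (R : realType) (n : nat) : set 'rV[R]_n :=
  [set theta | forall j, 0 <= theta ord0 j <= 2 * pi].

(* R e^{i Theta} *)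
Definition polar (R : realType) (n : nat) (r theta : 'rV[R]_n) :
    'rV[Cplx R]_n :=
  \row_j ((r ord0 j * cos (theta ord0 j)) +i* (r ord0 j * sin (theta ord0 j))).

Definition polydisc (R : realType) (n : nat) (z0 : 'rV[Cplx R]_n)
    (r : 'rV[R]_n) : set 'rV[Cplx R]_n :=
  [set z | forall j, cabs (z ord0 j - z0 ord0 j) <= r ord0 j].

Definition torus (R : realType) (n : nat) (r : 'rV[R]_n) :
    set 'rV[Cplx R]_n :=
  [set z | forall j, cabs (z ord0 j) = r ord0 j].

(* M(F, R); the supremum is a maximum when F is continuous on the torus. *)
Definition max_modulus (R : realType) (n : nat) (F : 'rV[Cplx R]_n -> Cplx R)
    (r : 'rV[R]_n) : R :=
  sup [set cabs (F z) | z in torus r].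

Definition mdeg (n : nat) (K : 'I_n -> nat) : nat := (\sum_j K j)%N.

Definition mfact (n : nat) (K : 'I_n -> nat) : nat := (\prod_j (K j)`!)%N.

Definition mpow (S : comPzRingType) (n : nat) (a : 'I_n -> S)
    (K : 'I_n -> nat) : S :=
  \prod_j a j ^+ K j.

(* The direction is a complex vector, so that 'D_ is the limit of difference
   quotients over complex increments, i.e. the holomorphic d/dz_j. *)
Definition pderiv (R : realType) (n : nat) (j : 'I_n)
    (F : 'rV[Cplx R]_n -> Cplx R) : 'rV[Cplx R]_n -> Cplx R :=
  fun z => 'D_(delta_mx ord0 j) F z.

Definition mderiv (R : realType) (n : nat) (K : 'I_n -> nat)
    (F : 'rV[Cplx R]_n -> Cplx R) : 'rV[Cplx R]_n -> Cplx R :=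
  foldr (fun j G => iter (K j) (pderiv j) G) F (enum 'I_n).

(* Every point of the ball has a neighbourhood on which F is the sum of a
   power series centred there.  The sum is taken along the filter of finite
   sets of multi-indices, which amounts to absolute convergence.  Values of F
   outside the ball are irrelevant. *)
Definition analytic_on_ball (R : realType) (n : nat)
    (F : 'rV[Cplx R]_n -> Cplx R) : Prop :=
  forall z0, unit_ball z0 ->
    exists (a : {ffun 'I_n -> nat} -> Cplx R) (rho : R), 0 < rho /\
      forall z : 'rV[Cplx R]_n,
        (forall j, cabs (z ord0 j - z0 ord0 j) < rho) ->
        partial_sum (fun K : {ffun 'I_n -> nat} =>
            a K * mpow (fun j => z ord0 j - z0 ord0 j) K)
          @ totally --> F z.

(* l_j(z) / l_j(z0) for z0 in the ball and z in D^n[z0, R / L(z0)].  When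
   |R| <= beta and l_j > beta / (1 - |.|), this polydisc lies in the ball. *)
Definition local_ratios (R : realType) (n : nat)
    (L : 'I_n -> 'rV[Cplx R]_n -> R) (j : 'I_n) (r : 'rV[R]_n) : set R :=
  [set x | exists z0 z, [/\ unit_ball z0,
     polydisc z0 (\row_k (r ord0 k / L k z0)) z & x = L j z / L j z0]].

Definition lambda1 (R : realType) (n : nat) (L : 'I_n -> 'rV[Cplx R]_n -> R)
    (j : 'I_n) (r : 'rV[R]_n) : \bar R :=
  ereal_inf [set x%:E | x in local_ratios L j r].

Definition lambda2 (R : realType) (n : nat) (L : 'I_n -> 'rV[Cplx R]_n -> R)
    (j : 'I_n) (r : 'rV[R]_n) : \bar R :=
  ereal_sup [set x%:E | x in local_ratios L j r].

Definition class_Q (R : realType) (n : nat) (beta : R)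
    (L : 'I_n -> 'rV[Cplx R]_n -> R) : Prop :=
  [/\ forall j z, unit_ball z -> 0 <= L j z,
      forall j z, unit_ball z -> {for z, continuous (L j)},
      forall j z, unit_ball z -> beta / (1 - cnorm z) < L j z &
      forall r, nonneg_vec r -> rnorm r <= beta -> forall j,
        [/\ (0 < lambda1 L j r)%E, (lambda1 L j r <= lambda2 L j r)%E &
            (lambda2 L j r < +oo)%E]].

(* L is in the class K(B^n), with c as a witness of the defining condition;
   the class itself is [exists c, class_K beta c L]. *)
Definition class_K (R : realType) (n : nat) (beta c : R)
    (L : 'I_n -> 'rV[Cplx R]_n -> R) : Prop :=
  [/\ forall j z, unit_ball z -> 0 < L j z,
      forall j z, unit_ball z -> {for z, continuous (L j)},
      forall j z, unit_ball z -> beta / (1 - cnorm z) < L j z,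
      1 <= c &
      forall r, nonneg_vec r -> rnorm r < 1 -> forall j theta1 theta2,
        angles theta1 -> angles theta2 ->
        L j (polar r theta2) / L j (polar r theta1) <= c].

(* |F^(K)(z)| / (K! L^K(z)) *)
Definition norm_deriv (R : realType) (n : nat)
    (L : 'I_n -> 'rV[Cplx R]_n -> R) (F : 'rV[Cplx R]_n -> Cplx R)
    (z : 'rV[Cplx R]_n) (K : 'I_n -> nat) : R :=
  cabs (mderiv K F z) / ((mfact K)%:R * mpow (fun j => L j z) K).

(* Multi-indices with ||K|| <= m have all entries <= m, whence the finite
   index type of the maximum. *)
Definition bounded_L_index (R : realType) (n : nat)
    (L : 'I_n -> 'rV[Cplx R]_n -> R) (F : 'rV[Cplx R]_n -> Cplx R) : Prop :=
  exists m : nat, forall z, unit_ball z -> forall J : 'I_n -> nat,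
    norm_deriv L F z J <=
    \big[Num.max/0]_(K : {ffun 'I_n -> 'I_m.+1} 
        | (mdeg (fun j => K j : nat) <= m)%N)
      norm_deriv L F z (fun j => K j : nat).

(* R(j, sigma, t) *)
Definition radii (R : realType) (n : nat) (r0 r : 'rV[R]_n) (j : 'I_n)
    (sigma : {perm 'I_n}) (t : R) : 'rV[R]_n :=
  \row_k (if (sigma k < sigma j)%N then r0 ord0 k
          else if k == j then t else r ord0 k).

(* The bound evaluates L at radii R(j, sigma, t) with 0 <= t <= r_j, and is
   meaningful only if all of them stay in the ball; this holds in particular
   if |R| < 1 and r0_k <= r_k for all k. *)
Definition admissible (R : realType) (n : nat) (r0 r : 'rV[R]_n) : Prop :=
  forall (sigma : {perm 'I_n}) (j : 'I_n) (t : R),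
    0 <= t <= r ord0 j -> rnorm (radii r0 r j sigma t) < 1.

Definition path_integral (R : realType) (n : nat)
    (L : 'I_n -> 'rV[Cplx R]_n -> R) (r0 r : 'rV[R]_n)
    (sigma : {perm 'I_n}) (theta : 'rV[R]_n) : R :=
  \sum_j \int[lebesgue_measure]_(t in `[0, r ord0 j])
     L j (polar (radii r0 r j sigma t) theta).

(* For admissible radii both infima are minima: the integrals depend
   continuously on theta, which ranges over a compact set. *)
Definition growth_bound (R : realType) (n : nat)
    (L : 'I_n -> 'rV[Cplx R]_n -> R) (r0 r : 'rV[R]_n) : R :=
  inf [set inf [set path_integral L r0 r sigma theta | theta in @angles R n]
      | sigma in [set: {perm 'I_n}]].

(* Main.v *)
Require Import Defs.
From mathcomp Require Import all_boot all_order all_algebra all_fingroup finmap.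
From mathcomp Require Import all_classical all_reals all_analysis.
From mathcomp Require Import complex.
From mathcomp Require Import analysis.showcase.summability.
From mathcomp Require Import ring lra.
Import Order.TTheory GRing.Theory Num.Theory.
Import numFieldNormedType.Exports.
Set Implicit Arguments.
Unset Strict Implicit.
Unset Printing Implicit Defensive.
Local Open Scope classical_set_scope.
Local Open Scope ring_scope.
Local Open Scope complex_scope.

(** At a point [z] put [gmax z] = max of [|F^(K)(z)| / (K! L^K(z))] over
    [|K| <= m], [m] being the index.  By the choice of [m] the derivatives of
    order [m + 1] are also bounded by [gmax], so along a radial segment shorter
    than [eps / l_j] the functions in this maximum solve, up to the variation
    of [L], a linear differential inequality with small constant, and [gmax]
    changes by a bounded factor only ([radial_step]).  The variation of [L] over
    such segments is bounded because [L] is in the class Q.  Cutting a longer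
    path into steps of this length, about one for each unit of the integral
    of [l_j], gives
    [gmax (end) <= C * exp (A * integral of l_j) * gmax (start)]
    ([integral_growth], [path_growth]).  Since [L] is in the class K, the integral
    may be computed at angles other than those of the path.

    Between two legs of the path it is better to use the maximum modulus [M],
    because a leg with [r_j < r0_j] must be crossed upwards, where no integral
    is available but [M] is monotone.  The passage is possible because [M] and
    the maximum of [gmax] over a torus are comparable.  One direction is trivial.
    For the other ([gmax_le_max_modulus]), Landau's inequality along inward
    radial segments bounds each derivative by lower ones plus a small multiple of
    higher ones, the latter being absorbed in [gmax]; in the end only values of
    [F] in the closed polydisc are left, and the maximum principle bounds them.

    Multiplying over the legs gives [M(F, r) <= C * exp (A * path integral) *
    M(F, r0)] for every permutation and all angles ([max_modulus_path]).  For the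
    lower bound, admissibility forces [r >= r0 / 2] near the boundary
    ([admissible_lower_bound]), so [M(F, r) >= M(F, r0 / 2)], and this is
    comparable with [M(F, r0)] by the same path estimate.  Path integrals are
    bounded below, which absorbs the additive constants.

    The derivatives of [F] and their commutation come from termwise
    differentiation of the local power series ([termwise_derivative],
    [pderiv_mderiv]); the maximum principle, from comparing [F] with its mean
    over four points [z + i^k h] ([maximum_principle]). *)

(** * The modulus of a complex number *)

Section Modulus.
Variable R : realType.
Implicit Types z w : Cplx R.

Lemma cabs_ge0 z : 0 <= cabs z.
Proof. by case: z => a b; exact: sqrtr_ge0. Qed.

Lemma cabs0 : cabs (0 : Cplx R) = 0.
Proof. exact: ComplexField.Normc.normc0. Qed.

Lemma cabs1 : cabs (1 : Cplx R) = 1.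
Proof. exact: ComplexField.Normc.normc1. Qed.

Lemma cabsM z w : cabs (z * w) = cabs z * cabs w.
Proof. exact: ComplexField.Normc.normcM. Qed.

Lemma cabsN z : cabs (- z) = cabs z.
Proof. exact: normcN. Qed.

Lemma cabsD z w : cabs (z + w) <= cabs z + cabs w.
Proof. exact: le_normcD. Qed.

Lemma cabsB z w : cabs (z - w) <= cabs z + cabs w.
Proof. by rewrite -(cabsN w); exact: cabsD. Qed.

Lemma cabsBC z w : cabs (z - w) = cabs (w - z).
Proof. by rewrite -cabsN opprB. Qed.

Lemma cabs_eq0 z : cabs z = 0 -> z = 0.
Proof. exact: ComplexField.Normc.eq0_normc. Qed.

Lemma cabs_gt0 z : (0 < cabs z) = (z != 0).
Proof.
rewrite lt_def cabs_ge0 andbT; congr negb.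
by apply/eqP/eqP => [/cabs_eq0//|->]; rewrite cabs0.
Qed.

Lemma cabsX z k : cabs (z ^+ k) = cabs z ^+ k.
Proof. by elim: k => [|k IH]; rewrite ?expr0 ?cabs1// !exprS cabsM IH. Qed.

Lemma cabsV z : cabs z^-1 = (cabs z)^-1.
Proof. exact: ComplexField.Normc.normcV. Qed.

Lemma cabs_real (x : R) : cabs (x%:C : Cplx R) = `|x|.
Proof. by rewrite /cabs/= expr0n/= addr0 sqrtr_sqr. Qed.

Lemma cabs_nat k : cabs (k%:R : Cplx R) = k%:R.
Proof.
have -> : (k%:R : Cplx R) = (k%:R : R)%:C by rewrite (rmorph_nat (real_complex R)).
by rewrite cabs_real ger0_norm.
Qed.

Lemma cabs_sum (I : Type) (r : seq I) (P : pred I) (f : I -> Cplx R) :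
  cabs (\sum_(i <- r | P i) f i) <= \sum_(i <- r | P i) cabs (f i).
Proof.
elim/big_ind2: _ => [|a b c d ab cd|//]; first by rewrite cabs0.
by apply: le_trans (cabsD _ _) _; exact: lerD.
Qed.

Lemma cabs_prod (I : Type) (r : seq I) (P : pred I) (f : I -> Cplx R) :
  cabs (\prod_(i <- r | P i) f i) = \prod_(i <- r | P i) cabs (f i).
Proof. by elim/big_ind2: _ => [|a b c d <- <-|//]; rewrite ?cabs1 ?cabsM. Qed.

Lemma Re_le_cabs z : `|complex.Re z| <= cabs z.
Proof.
case: z => a b; rewrite /cabs/= -sqrtr_sqr ler_wsqrtr// lerDl.
exact: sqr_ge0.
Qed.

Lemma Im_le_cabs z : `|complex.Im z| <= cabs z.
Proof.
case: z => a b; rewrite /cabs/= -sqrtr_sqr ler_wsqrtr// lerDr.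
exact: sqr_ge0.
Qed.

Lemma cabs_le_ReIm z : cabs z <= `|complex.Re z| + `|complex.Im z|.
Proof.
case: z => a b; rewrite /cabs/= -(ler_pXn2r (n := 2)) ?nnegrE ?sqrtr_ge0 ?addr_ge0//.
rewrite sqr_sqrtr ?addr_ge0 ?sqr_ge0// sqrrD !real_normK ?num_real//.
rewrite addrAC lerDl mulrn_wge0// mulr_ge0//.
Qed.

(** The norm that induces the topology of [Cplx R] is complex-valued; limits are
    restated with the real-valued modulus, which is used from here on. *)
Lemma cvg_cabsP (T : Type) (G : set_system T) (FF : Filter G)
    (f : T -> Cplx R) (l : Cplx R) :
  f @ G --> l <-> forall e, 0 < e -> \forall t \near G, cabs (l - f t) < e.
Proof.
split=> [/cvgrPdist_lt H e e0|H].
  have e0' : (0 : Cplx R) < e%:C by rewrite ltcR.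
  by apply: filterS (H _ e0') => t Ht; rewrite -ltcR; exact: Ht.
apply/cvgrPdist_lt => e e0.
have re : e = (complex.Re e)%:C.
  by move: e0; case: e => a b; rewrite ltcE/= => /andP[/eqP ->].
move: e0; rewrite re ltcR => e0.
by apply: (filterS _ (H _ e0)) => t Ht; rewrite -ltcR in Ht; exact: Ht.
Qed.

End Modulus.

(** * Unconditional sums over multi-indices *)

Section FiniteSums.
#[local] Existing Instance totally_filter.

Lemma sum_fsetD (I : choiceType) (V : zmodType) (A B : {fset I}) (f : I -> V) :
  (A `<=` B)%fset ->
  \sum_(K <- B) f K = \sum_(K <- A) f K + \sum_(K <- (B `\` A)%fset) f K.
Proof.
move=> AB; rewrite (big_fsetID _ (mem A)) /=; congr (_ + _).
  apply: eq_fbigl => x; rewrite !inE/=.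
  by apply/andP/idP => [[]//|xA]; split => //; exact: (fsubsetP AB).
by apply: eq_fbigl => x; rewrite !inE/= andbC.
Qed.

Lemma ler_sum_fsubset (R : numDomainType) (I : choiceType) (A B : {fset I})
    (f : I -> R) :
  (forall i, 0 <= f i) -> (A `<=` B)%fset -> \sum_(K <- A) f K <= \sum_(K <- B) f K.
Proof.
by move=> f0 /sum_fsetD ->; rewrite lerDl; apply: sumr_ge0.
Qed.

Lemma totally_sumP (R : realType) (I : choiceType) (f : I -> Cplx R)
    (l : Cplx R) :
  partial_sum f @ totally --> l <-> forall e, 0 < e ->
    exists A0 : {fset I}, forall A, (A0 `<=` A)%fset ->
      cabs (l - \sum_(K <- A) f K) < e.
Proof.
have E A : partial_sum f A = \sum_(K <- A) f K by rewrite big_seq_fsetE.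
rewrite cvg_cabsP; split=> H e e0.
  have [A0 _ HA] := H _ e0; exists A0 => A AA; rewrite -E.
  exact: (HA A AA).
have [A0 HA] := H _ e0; exists A0 => // A AA; rewrite /= E; exact: HA.
Qed.

(** A family whose finite sums are bounded has small sums away from a suitable
    finite set: take a finite set whose sum is close to the supremum. *)
Lemma small_tails (R : realType) (I : choiceType) (f : I -> R) (C : R) :
  (forall i, 0 <= f i) -> (forall A : {fset I}, \sum_(K <- A) f K <= C) ->
  forall e, 0 < e -> exists A0 : {fset I}, forall A, [disjoint A0 & A]%fset ->
    \sum_(K <- A) f K <= e.
Proof.
move=> f0 fC e e0.
pose S : set R := [set \sum_(K <- A) f K | A in [set: {fset I}]].
have hS : has_sup S.
  split; first by exists (\sum_(K <- fset0) f K), fset0.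
  by exists C => _ [A _ <-]; exact: fC.
have [_ [A0 _ <-] HA] := sup_adherent e0 hS.
exists A0 => A dA.
have le : \sum_(K <- (A0 `|` A)%fset) f K <= sup S.
  by apply: sup_upper_bound => //; exists ((A0 `|` A)%fset).
have : \sum_(K <- (A0 `|` A)%fset) f K = \sum_(K <- A0) f K + \sum_(K <- A) f K.
  rewrite (@sum_fsetD _ _ A0) ?fsubsetUl//; congr (_ + _).
  apply: eq_fbigl => x; rewrite !inE/=.
  case xA: (x \in A); rewrite ?orbT ?orbF ?andbT ?andNb//.
  by apply/negP => xA0; move/fdisjointP: dA => /(_ _ xA0); rewrite xA.
move=> E; move: le; rewrite E => le.
by move: HA; lra.
Qed.

(** From some finite set on, adding one more term changes the partial sum by
    at most 2; the finitely many remaining terms are added to the bound. *)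
Lemma terms_bounded (R : realType) (I : choiceType) (f : I -> Cplx R)
    (l : Cplx R) :
  partial_sum f @ totally --> l -> exists2 B : R, 0 < B & forall K, cabs (f K) <= B.
Proof.
move=> /totally_sumP/(_ 1 ltr01)[A0 HA].
exists (2 + \sum_(K <- A0) cabs (f K)).
  by rewrite ltr_wpDr// sumr_ge0// => *; exact: cabs_ge0.
move=> K; have [KA|KA] := boolP (K \in A0).
  rewrite (big_fsetD1 K KA)/= addrCA lerDl addr_ge0// sumr_ge0// => *.
  exact: cabs_ge0.
have : cabs (\sum_(i <- (K |` A0)%fset) f i - \sum_(i <- A0) f i) <= 2.
  have -> : \sum_(i <- (K |` A0)%fset) f i - \sum_(i <- A0) f i =
    (l - \sum_(i <- A0) f i) - (l - \sum_(i <- (K |` A0)%fset) f i) by ring.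
  apply: le_trans (cabsB _ _) _.
  have := HA _ (fsubset_refl _); have := HA _ (fsubsetU1 K A0); lra.
rewrite big_fsetU1//= addrK => H; apply: le_trans H _; rewrite lerDl.
by apply: sumr_ge0 => *; exact: cabs_ge0.
Qed.

Lemma totally_sum_le (R : realType) (I : choiceType) (f : I -> Cplx R)
    (l : Cplx R) (A0 : {fset I}) (C : R) : partial_sum f @ totally --> l ->
  (forall A, (A0 `<=` A)%fset -> \sum_(K <- (A `\` A0)%fset) cabs (f K) <= C) ->
  cabs (l - \sum_(K <- A0) f K) <= C.
Proof.
move=> /totally_sumP fl H; apply/ler_addgt0Pr => e e0.
have [A1 HA] := fl _ e0.
have := HA _ (fsubsetUr A0 A1); rewrite (sum_fsetD _ (fsubsetUl A0 A1)) => le1.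
set X := \sum_(K <- A0) f K in le1 *; set Y := \sum_(K <- _) f K in le1.
have -> : l - X = (l - (X + Y)) + Y by ring.
apply: le_trans (cabsD _ _) _; rewrite addrC lerD ?(ltW le1)//.
by apply: le_trans (cabs_sum _ _ _) _; apply: H; exact: fsubsetUl.
Qed.

End FiniteSums.

Section MultiIndex.
Variables (R : realType) (n : nat).
Local Notation midx := {ffun 'I_n -> nat}.

Lemma mpow_const (S : comPzRingType) (x : S) (K : 'I_n -> nat) :
  mpow (fun=> x) K = x ^+ mdeg K.
Proof. by rewrite /mpow /mdeg prodrXr. Qed.

(** The sum over a box of multi-indices factors into [n] geometric sums. *)
Lemma geometric_sum_le (q : R) (A : {fset midx}) : 0 <= q < 1 ->
  \sum_(K <- A) q ^+ mdeg K <= ((1 - q)^-1) ^+ n.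
Proof.
move=> /andP[q0 q1].
pose N := (\max_(K <- A) \max_j K j)%N.
pose emb (K : {ffun 'I_n -> 'I_N.+1}) : midx := [ffun j => K j : nat].
pose B := [fset emb K | K in enum {ffun 'I_n -> 'I_N.+1}]%fset.
have AB : (A `<=` B)%fset.
  apply/fsubsetP => K KA; apply/imfsetP => /=.
  have KN j : (K j < N.+1)%N.
    rewrite ltnS; apply: (@leq_trans (\max_j K j)%N); first exact: leq_bigmax.
    by rewrite /N (big_rem K KA)/= leq_max leqnn.
  exists [ffun j => Ordinal (KN j)]; first by rewrite mem_enum.
  by apply/ffunP => j; rewrite !ffunE.
apply: le_trans (ler_sum_fsubset _ AB) _ => [K|]; first exact: exprn_ge0.
rewrite big_imfset/=; last first.
  move=> K K' _ _ /ffunP H; apply/ffunP => j; apply: val_inj.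
  by have := H j; rewrite !ffunE.
rewrite undup_id ?enum_uniq// big_enum/=.
have -> : \sum_(K : {ffun 'I_n -> 'I_N.+1}) q ^+ mdeg (emb K) =
   \prod_(j < n) \sum_(i < N.+1) q ^+ i.
  rewrite bigA_distr_bigA/=; apply: eq_bigr => K _.
  by rewrite -prodrXr; apply: eq_bigr => j _; rewrite ffunE.
rewrite -[n in leRHS]card_ord -prodr_const.
apply: ler_prod => j _; rewrite sumr_ge0/=; last by move=> *; exact: exprn_ge0.
rewrite -[leRHS]mul1r ler_pdivlMr ?subr_gt0//.
have -> : (\sum_(i < N.+1) q ^+ i) * (1 - q) = 1 - q ^+ N.+1.
  by rewrite -[RHS]opprB subrX1; ring.
by rewrite gerBl exprn_ge0.
Qed.

End MultiIndex.

(** * Increments of monomials *)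

Section Monomials.
Variables (R : realType) (n : nat).
Local Notation midx := {ffun 'I_n -> nat}.
Implicit Types (w : 'I_n -> Cplx R) (K : 'I_n -> nat) (j : 'I_n).

Lemma mdegD1 K j : mdeg K = (K j + \sum_(i | i != j) K i)%N.
Proof. by rewrite /mdeg (bigD1 j). Qed.

Lemma cabs_mpow w K : cabs (mpow w K) = mpow (fun k => cabs (w k)) K.
Proof. by rewrite /mpow cabs_prod; apply: eq_bigr => i _; rewrite cabsX. Qed.

Definition shift_at j (h : Cplx R) w : 'I_n -> Cplx R :=
  fun k => w k + (if k == j then h else 0).

Definition mpow_off j w K : Cplx R := \prod_(k | k != j) w k ^+ K k.

(** The derivative of the monomial in its [j]-th variable. *)
Definition dmpow j w K : Cplx R := (K j)%:R * w j ^+ (K j).-1 * mpow_off j w K.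

Lemma mpow_shift_at j h w K :
  mpow (shift_at j h w) K = (w j + h) ^+ K j * mpow_off j w K.
Proof.
rewrite /mpow (bigD1 j)//= /shift_at eqxx; congr (_ * _).
by apply: eq_bigr => k /negbTE ->; rewrite addr0.
Qed.

Lemma mpowD1 j w K : mpow w K = w j ^+ K j * mpow_off j w K.
Proof. by rewrite /mpow (bigD1 j). Qed.

Lemma cabs_mpow_off j w K (t : R) : (forall k, cabs (w k) <= t) ->
  cabs (mpow_off j w K) <= t ^+ (\sum_(i | i != j) K i)%N.
Proof.
move=> wt; rewrite /mpow_off cabs_prod -prodrXr.
apply: ler_prod => k _; rewrite cabs_ge0 cabsX lerXn2r ?nnegrE ?cabs_ge0//.
exact: le_trans (cabs_ge0 _) (wt k).
Qed.

Lemma cabs_subX (x y : Cplx R) (t : R) k : cabs x <= t -> cabs y <= t ->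
  cabs (x ^+ k - y ^+ k) <= cabs (x - y) * (k%:R * t ^+ k.-1).
Proof.
move=> xt yt; have t0 : 0 <= t := le_trans (cabs_ge0 _) xt.
rewrite subrXX cabsM ler_wpM2l ?cabs_ge0//.
apply: le_trans (cabs_sum _ _ _) _.
rewrite mulr_natl (_ : _ *+ k = \sum_(i < k) t ^+ k.-1); last first.
  by rewrite sumr_const card_ord.
apply: ler_sum => i _; rewrite cabsM !cabsX.
have -> : t ^+ k.-1 = t ^+ (k.-1 - i) * t ^+ i.
  by rewrite -exprD subnK//; case: k i => [[]//|k] i; rewrite -ltnS.
apply: ler_pM; rewrite ?exprn_ge0 ?cabs_ge0//.
  by rewrite lerXn2r ?nnegrE ?cabs_ge0.
by rewrite lerXn2r ?nnegrE ?cabs_ge0.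
Qed.

(** The factor [k] that differentiation brings down is absorbed by a slightly
    larger radius. *)
Lemma natr_expr_le (s t : R) k : 0 <= t -> t <= s ->
  (s - t) * (k%:R * t ^+ k.-1) <= s ^+ k.
Proof.
move=> t0 ts; elim: k => [|k IH]; first by rewrite mul0r mulr0.
have s0 := le_trans t0 ts.
rewrite exprS /= (_ : (s - t) * _ = (s - t) * (k%:R * t ^+ k) + (s - t) * t ^+ k).
  2: by rewrite -natr1; ring.
have tk : t ^+ k <= s ^+ k by rewrite lerXn2r ?nnegrE.
have A : (s - t) * (k%:R * t ^+ k) <= t * s ^+ k.
  case: k IH tk => [|k] IH tk; first by rewrite mul0r mulr0 mulr_ge0// exprn_ge0.
  rewrite (_ : _ * (_ * t ^+ k.+1) = t * ((s - t) * (k.+1%:R * t ^+ k))).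
  2: by rewrite exprS; ring.
  by rewrite ler_wpM2l.
have B : (s - t) * t ^+ k <= (s - t) * s ^+ k by rewrite ler_wpM2l// subr_ge0.
by apply: le_trans (lerD A B) _; rewrite -mulrDl addrC subrK.
Qed.

Lemma cabs_mpow_incr j h w K (s t : R) :
  (forall k, cabs (w k) <= t) -> cabs (w j) + cabs h <= t -> t < s ->
  cabs (mpow (shift_at j h w) K - mpow w K) <= cabs h * (s ^+ mdeg K / (s - t)).
Proof.
move=> wt wht ts; have t0 : 0 <= t := le_trans (cabs_ge0 _) (wt j).
rewrite mpow_shift_at (mpowD1 j w) -mulrBl cabsM.
have H1 : cabs ((w j + h) ^+ K j - w j ^+ K j) <= cabs h * ((K j)%:R * t ^+ (K j).-1).
  apply: le_trans (@cabs_subX _ _ t _ _ (wt j)) _.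
    by apply: le_trans (cabsD _ _) _.
  by rewrite addrAC subrr add0r.
have H2 := cabs_mpow_off j K wt.
apply: le_trans (ler_pM _ _ H1 H2) _; rewrite ?cabs_ge0//.
rewrite -!mulrA ler_wpM2l ?cabs_ge0// ler_pdivlMr ?subr_gt0//.
rewrite (mdegD1 K j); set N := (\sum_(i | _) _)%N.
rewrite exprD mulrC !mulrA.
apply: ler_pM; rewrite ?exprn_ge0//.
- by rewrite !mulr_ge0 ?exprn_ge0// subr_ge0 ltW.
- by rewrite -mulrA; exact: natr_expr_le (ltW ts).
- by rewrite lerXn2r ?nnegrE ?(ltW ts)// (le_trans t0 (ltW ts)).
Qed.

Lemma exprD_second_order (x : Cplx R) k : exists2 C : R, 0 <= C &
  forall h, cabs h <= 1 ->
    cabs ((x + h) ^+ k - x ^+ k - h * (k%:R * x ^+ k.-1)) <= C * cabs h ^+ 2.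
Proof.
elim: k => [|k [C C0 IH]].
  by exists 0 => // h _; rewrite !expr0 subrr mul0r mulr0 subrr cabs0 mul0r.
exists ((cabs x + 1) * C + cabs (k%:R * x ^+ k.-1)).
  by rewrite addr_ge0 ?mulr_ge0 ?addr_ge0 ?cabs_ge0.
move=> h h1.
have -> : (x + h) ^+ k.+1 - x ^+ k.+1 - h * (k.+1%:R * x ^+ k.+1.-1) =
   (x + h) * ((x + h) ^+ k - x ^+ k - h * (k%:R * x ^+ k.-1))
   + h ^+ 2 * (k%:R * x ^+ k.-1).
  rewrite /= -natr1 !exprS.
  by case: k {IH} => [|k]; rewrite ?expr0 /= ?exprS; ring.
apply: le_trans (cabsD _ _) _; rewrite [leRHS]mulrDl; apply: lerD.
  rewrite cabsM -mulrA; apply: ler_pM; rewrite ?cabs_ge0 ?IH//.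
  by apply: le_trans (cabsD _ _) _; rewrite lerD2l.
by rewrite cabsM cabsX mulrC.
Qed.

Lemma mpow_second_order j w K : exists2 C : R, 0 <= C &
  forall h, cabs h <= 1 ->
    cabs (mpow (shift_at j h w) K - mpow w K - h * dmpow j w K) <= C * cabs h ^+ 2.
Proof.
have [C C0 H] := exprD_second_order (w j) (K j).
exists (C * cabs (mpow_off j w K)); first by rewrite mulr_ge0 ?cabs_ge0.
move=> h h1; rewrite mpow_shift_at (mpowD1 j w) /dmpow.
set P := mpow_off j w K.
have -> : (w j + h) ^+ K j * P - w j ^+ K j * P - h * ((K j)%:R * w j ^+ (K j).-1 * P)
  = ((w j + h) ^+ K j - w j ^+ K j - h * ((K j)%:R * w j ^+ (K j).-1)) * P by ring.
by rewrite cabsM mulrAC ler_wpM2r ?cabs_ge0// H.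
Qed.

End Monomials.

(** * Expansion along an axis through the centre *)

Section PowerSeries.
Variables (R : realType) (n : nat).
Local Notation midx := {ffun 'I_n -> nat}.
Local Notation vec := 'rV[Cplx R]_n.
Local Notation e_ j := (delta_mx ord0 j : vec).
Implicit Types (F : vec -> Cplx R) (z : vec) (j : 'I_n) (h : Cplx R).

Definition expansion F z0 (a : midx -> Cplx R) (rho : R) := 0 < rho /\
  forall z : vec, (forall j, cabs (z ord0 j - z0 ord0 j) < rho) ->
    partial_sum (fun K : midx => a K * mpow (fun j => z ord0 j - z0 ord0 j) K)
      @ totally --> F z.

Definition axis j (k : nat) : midx := [ffun i => if i == j then k else 0%N].

Definition succ_at j (K : midx) : midx :=
  [ffun i => if i == j then (K i).+1 else K i].

Lemma shiftE z j h k : (z + h *: e_ j) ord0 k = z ord0 k + (if k == j then h else 0).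
Proof. by rewrite !mxE eqxx/= mulr_natr mulrb. Qed.

(** Evaluate the series at the corner [z0 + (s, .., s)] of a polydisc. *)
Lemma coef_bound F z0 a rho s : expansion F z0 a rho -> 0 <= s < rho ->
  exists2 B : R, 0 < B & forall K, cabs (a K) * s ^+ mdeg K <= B.
Proof.
move=> [rho0 H] /andP[s0 srho].
pose z : vec := \row_j (z0 ord0 j + s%:C).
have zz j : z ord0 j - z0 ord0 j = s%:C by rewrite mxE addrAC subrr add0r.
have [|B B0 HB] := terms_bounded (H z _).
  by move=> j; rewrite zz cabs_real ger0_norm.
exists B => // K; apply: le_trans (HB K); rewrite cabsM cabs_mpow.
rewrite -mpow_const le_eqVlt; apply/orP; left; apply/eqP; congr (_ * _).
by apply: eq_bigr => j _; rewrite zz cabs_real ger0_norm.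
Qed.

Lemma mdeg_axis j k : mdeg (axis j k) = k.
Proof.
rewrite (mdegD1 _ j) /axis ffunE eqxx big1 ?addn0// => i /negbTE ij.
by rewrite ffunE ij.
Qed.

Lemma mpow_axis j h (K : midx) :
  mpow (fun k => if k == j then h else 0) K =
  if K == axis j (K j) then h ^+ K j else 0.
Proof.
rewrite (mpowD1 j)/= eqxx /mpow_off; case: eqP => [->|H].
  rewrite [X in _ * X]big1 ?mulr1 ?ffunE ?eqxx// => i /negbTE ij.
  by rewrite !ffunE ij expr0.
have [i /andP[ij Ki]] : exists i, (i != j) && (K i != 0%N).
  apply: contrapT => HN; apply: H; apply/ffunP => i; rewrite ffunE.
  case: eqP => [->//|/eqP ij]; apply/eqP/negPn/negP => Ki.
  by apply: HN; exists i; rewrite ij.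
rewrite (bigD1 i)//= (negbTE ij) expr0n (negbTE Ki) mul0r mulr0//.
Qed.

(** Along a coordinate axis only the pure powers of that coordinate survive;
    the rest of the series is a geometric tail. *)
Lemma center_taylor F z0 a rho j p : expansion F z0 a rho ->
  exists C delta, [/\ 0 <= C, 0 < delta & forall h, cabs h < delta ->
    cabs (F (z0 + h *: e_ j) - \sum_(k < p) a (axis j k) * h ^+ k)
      <= C * cabs h ^+ p].
Proof.
move=> Fz0; have rho0 : 0 < rho by case: Fz0.
have [s /andP[s0 s_rho]] : exists s : R, 0 < s < rho by exists (rho / 2); lra.
have srho : 0 <= s < rho by lra.
have [B B0 HB] := coef_bound Fz0 srho.
pose C := B * (2 / s) ^+ p * ((1 - 2^-1 : R)^-1) ^+ n.
have half : 0 <= (2^-1 : R) < 1 by lra.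
have C0 : 0 <= C.
  by rewrite /C !mulr_ge0 ?exprn_ge0 ?divr_ge0 ?invr_ge0 ?(ltW B0) ?(ltW s0)//; lra.
(* for |h| < s / 2 the omitted terms are dominated by powers of 1 / 2 *)
exists C, (s / 2); split => //; first by rewrite divr_gt0.
move=> h hs; have h0 := cabs_ge0 h.
pose f (K : midx) := a K * mpow (fun k => (z0 + h *: e_ j) ord0 k - z0 ord0 k) K.
have fE K : f K = a K * (if K == axis j (K j) then h ^+ K j else 0).
  rewrite -mpow_axis /f; congr (_ * _); apply: eq_bigr => k _.
  by rewrite shiftE addrAC subrr add0r.
pose A0 := [fset axis j k | k in iota 0 p]%fset.
have sumA0 : \sum_(K <- A0) f K = \sum_(k < p) a (axis j k) * h ^+ k.
  rewrite big_imfset/=; last first.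
    by move=> x y _ _ /ffunP/(_ j); rewrite !ffunE eqxx.
  rewrite undup_id ?iota_uniq// (_ : iota 0 p = index_iota 0 p); last first.
    by rewrite /index_iota subn0.
  rewrite big_mkord.
  by apply: eq_bigr => k _; rewrite fE ffunE eqxx eqxx.
rewrite -sumA0; apply: totally_sum_le.
  case: Fz0 => _; apply => k; rewrite shiftE addrAC subrr add0r.
  by case: eqP => _; rewrite ?cabs0// (lt_trans hs)//; lra.
move=> A A0A.
have le K : K \in (A `\` A0)%fset ->
    cabs (f K) <= B * (2 / s) ^+ p * cabs h ^+ p * 2^-1 ^+ mdeg K.
  rewrite inE => /andP[KA0 _]; rewrite fE.
  have rhs0 : 0 <= B * (2 / s) ^+ p * cabs h ^+ p * 2^-1 ^+ mdeg K.
    by rewrite !mulr_ge0 ?exprn_ge0 ?invr_ge0 ?divr_ge0 ?(ltW B0) ?(ltW s0).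
  case: eqP => [KE|_]; last by rewrite mulr0 cabs0.
  have pK : (p <= K j)%N.
    rewrite leqNgt; apply: contra KA0 => Kp; apply/imfsetP; exists (K j) => //=.
    by rewrite mem_iota.
  have mK : mdeg K = K j by rewrite [in LHS]KE mdeg_axis.
  rewrite cabsM cabsX mK.
  have HB' : cabs (a K) * s ^+ K j <= B by rewrite -mK.
  apply: (@le_trans _ _ ((cabs (a K) * s ^+ K j) * ((cabs h / s) ^+ K j))).
    rewrite -mulrA ler_wpM2l ?cabs_ge0// exprMn exprVn mulrCA divff ?mulr1//.
    by rewrite expf_neq0// gt_eqF.
  have -> : B * (2 / s) ^+ p * cabs h ^+ p * 2^-1 ^+ K j =
            B * ((cabs h / s) ^+ p * 2^-1 ^+ (K j - p)).
    rewrite -[in LHS](subnK pK) exprD !exprMn.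
    transitivity (B * ((cabs h ^+ p * s^-1 ^+ p) * 2^-1 ^+ (K j - p)) *
      (2 ^+ p * 2^-1 ^+ p)).
      by move: (2 ^+ p) (2^-1 ^+ p) (2^-1 ^+ _) => *; ring.
    by rewrite -[_ ^+ p * 2^-1 ^+ p]exprMn divff// expr1n mulr1.
  apply: ler_pM => //.
  - by rewrite mulr_ge0 ?cabs_ge0 ?exprn_ge0 ?(ltW s0).
  - by rewrite exprn_ge0 ?divr_ge0 ?cabs_ge0 ?(ltW s0).
  rewrite -{1}(subnKC pK) exprD ler_wpM2l ?exprn_ge0 ?divr_ge0 ?(ltW s0)//.
  rewrite lerXn2r ?nnegrE ?divr_ge0 ?invr_ge0 ?(ltW s0)//.
  by rewrite ler_pdivrMr//; lra.
rewrite (eq_big_seq (fun K => cabs (f K))) //=.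
apply: (@le_trans _ _ (\sum_(K <- (A `\` A0)%fset)
    B * (2 / s) ^+ p * cabs h ^+ p * 2^-1 ^+ mdeg K)).
  by rewrite big_seq [leRHS]big_seq; apply: ler_sum => K /le.
rewrite -mulr_sumr /C [leRHS]mulrAC
  ler_wpM2l//; last exact: geometric_sum_le.
by rewrite !mulr_ge0 ?exprn_ge0 ?divr_ge0 ?(ltW B0) ?(ltW s0).
Qed.

Lemma center_second_order F z0 a rho j : expansion F z0 a rho ->
  exists C delta, [/\ 0 <= C, 0 < delta & forall h, cabs h < delta ->
    cabs (F (z0 + h *: e_ j) - F z0 - h * a (axis j 1)) <= C * cabs h ^+ 2].
Proof.
move=> Fz0; have [C [d [C0 d0 H]]] := center_taylor j 2 Fz0.
have F0 : F z0 = a (axis j 0).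
  have := H 0; rewrite cabs0 => /(_ d0).
  rewrite scale0r addr0 expr0n mulr0 !big_ord_recl big_ord0 /= !expr0 mulr1.
  rewrite expr0n/= mulr0 !addr0 => H0; apply/eqP; rewrite -subr_eq0; apply/eqP.
  by apply: cabs_eq0; apply/eqP; rewrite eq_le H0 cabs_ge0.
exists C, d; split=> // h hd; rewrite F0.
have := H _ hd; rewrite !big_ord_recl big_ord0 /= expr0 mulr1 addr0 expr1.
by rewrite opprD addrA (mulrC h).
Qed.

Lemma derive_second_order F z j d :
  (exists C delta, [/\ 0 <= C, 0 < delta & forall h, cabs h < delta ->
    cabs (F (z + h *: e_ j) - F z - h * d) <= C * cabs h ^+ 2]) ->
  pderiv j F z = d.
Proof.
move=> [C [delta [C0 delta0 H]]].
rewrite /pderiv /derive; apply: cvg_lim; first exact: norm_hausdorff.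
apply/cvg_cabsP => e e0.
have m0 : 0 < Num.min delta (e / (C + 1)).
  by rewrite lt_min delta0 divr_gt0// ltr_wpDl.
near=> h.
have hn0 : h != 0 by near: h; exact: nbhs_dnbhs_neq.
have hh : 0 < cabs h by rewrite cabs_gt0.
have hm : cabs h < Num.min delta (e / (C + 1)).
  near: h; have /cvg_cabsP/(_ _ m0) : h @[h --> (0 : Cplx R)^'] --> (0 : Cplx R).
    exact: cvg_within.
  by apply: filterS => x; rewrite sub0r cabsN.
move: hm; rewrite lt_min => /andP[hd he].
rewrite /shift/= (addrC _ z).
have -> : d - h^-1 *: (F (z + h *: e_ j) - F z) =
    - (h^-1 * (F (z + h *: e_ j) - F z - h * d)).
  rewrite mulrBr mulrA mulVf// mul1r opprB; congr (_ - _).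
rewrite cabsN cabsM cabsV mulrC ltr_pdivrMr//.
apply: le_lt_trans (H _ hd) _; rewrite expr2 mulrA ltr_pM2r//.
move: he; rewrite ltr_pdivlMr ?ltr_wpDl// => he; apply: le_lt_trans he.
rewrite mulrC ler_wpM2l ?(ltW hh)//; lra.
Unshelve. all: by end_near. Qed.

End PowerSeries.

(** * Partial derivatives of analytic functions *)

Section DerivativeExpansion.
Variables (R : realType) (n : nat).
Local Notation midx := {ffun 'I_n -> nat}.
Local Notation vec := 'rV[Cplx R]_n.
Local Notation e_ j := (delta_mx ord0 j : vec).
Implicit Types (F : vec -> Cplx R) (z : vec) (j : 'I_n) (h : Cplx R).

Lemma fin_lt_lub (I : finType) (x : I -> R) (rho : R) : 0 < rho ->
  (forall i, x i < rho) -> exists2 s, 0 < s < rho & forall i, x i <= s.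
Proof.
move=> rho0 xr; pose s := \big[Num.max/(rho / 2)]_i x i.
exists s; last by move=> i; exact: le_bigmax.
apply/andP; split; first by apply: lt_le_trans (bigmax_ge_id _ _ _ _); lra.
apply: bigmax_lt => //; lra.
Qed.

(** Termwise differentiation away from the centre.  That [d] exists is known
    beforehand, from the expansion centred at [z]; the increments of all but
    finitely many terms are uniformly small against [h], so [d] is within any
    tolerance of the termwise derivatives of the remaining ones. *)
Lemma termwise_derivative F z0 a rho z j d : expansion F z0 a rho ->
  (forall k, cabs (z ord0 k - z0 ord0 k) < rho) ->
  (exists C delta, [/\ 0 <= C, 0 < delta & forall h, cabs h < delta ->
    cabs (F (z + h *: e_ j) - F z - h * d) <= C * cabs h ^+ 2]) ->
  partial_sum (fun K : midx =>
    a K * dmpow j (fun k => z ord0 k - z0 ord0 k) K) @ totally --> d.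
Proof.
move=> Fz0 zr [C [delta [C0 delta0 Hd]]].
have rho0 : 0 < rho by case: Fz0.
pose w := fun k => z ord0 k - z0 ord0 k.
have [r /andP[r0 rr] wr] := fin_lt_lub rho0 zr.
(* increments are estimated on radius t, where they cost the radius s;
   s' > s leaves a geometric tail of ratio q *)
pose g := (rho - r) / 4; have g0 : 0 < g by rewrite divr_gt0 ?subr_gt0.
pose t := r + g; pose s := r + 2 * g; pose s' := r + 3 * g.
have tpos : 0 < t by rewrite /t; lra.
have ts : t < s by rewrite /t /s; lra.
have ss' : s < s' by rewrite /s /s'; lra.
have s'rho : 0 <= s' < rho by rewrite /s' /g; lra.
have spos : 0 < s by lra.
have s'pos : 0 < s' by lra.
have [B B0 HB] := coef_bound Fz0 s'rho.
pose q := s / s'.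
have q01 : 0 <= q < 1.
  by rewrite divr_ge0 ?(ltW spos) ?(ltW s'pos)//= ltr_pdivrMr ?mul1r.
pose D := B / (s - t); have D0 : 0 < D by rewrite divr_gt0// subr_gt0.
have inc h (K : midx) : cabs h <= g ->
    cabs (a K * (mpow (shift_at j h w) K - mpow w K)) <= cabs h * (D * q ^+ mdeg K).
  move=> hg; rewrite cabsM.
  have wt k : cabs (w k) <= t by apply: le_trans (wr k) _; rewrite /t lerDl ltW.
  have wht : cabs (w j) + cabs h <= t by rewrite /t lerD//; exact: wr.
  apply: le_trans (ler_wpM2l (cabs_ge0 _)
    (@cabs_mpow_incr _ _ j h w K s t wt wht ts)) _.
  rewrite mulrCA ler_wpM2l ?cabs_ge0// /D /q exprMn exprVn.
  rewrite (_ : cabs (a K) * (s ^+ mdeg K / (s - t)) =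
     (cabs (a K) * s' ^+ mdeg K) * (s ^+ mdeg K / s' ^+ mdeg K / (s - t))).
    rewrite (_ : B / (s - t) * _ = B * (s ^+ mdeg K / s' ^+ mdeg K / (s - t))).
      rewrite ler_wpM2r// !divr_ge0 ?exprn_ge0 ?(ltW spos) ?(ltW s'pos)//.
      by rewrite subr_ge0 ltW.
    by rewrite mulrAC -!mulrA.
  rewrite [s ^+ _ / s' ^+ _]mulrC !mulrA mulfK// expf_neq0// gt_eqF//.
apply/totally_sumP => e e0.
pose tail (K : midx) := D * q ^+ mdeg K.
have tail0 K : 0 <= tail K.
  by rewrite mulr_ge0 ?(ltW D0) ?exprn_ge0//; case/andP: q01.
have tailC (A : {fset midx}) : \sum_(K <- A) tail K <= D * ((1 - q)^-1 ^+ n).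
  rewrite -mulr_sumr; apply: ler_wpM2l; first exact: ltW.
  exact: geometric_sum_le.
have [A0 HA0] := small_tails tail0 tailC (divr_gt0 e0 (ltr0n _ 4)).
exists A0 => A A0A.
have [Dm Dm0 HDm] : exists2 Dm : midx -> R, (forall K, 0 <= Dm K) &
    forall (K : midx) h, cabs h <= 1 ->
    cabs (mpow (shift_at j h w) K - mpow w K - h * dmpow j w K) <= Dm K * cabs h ^+ 2.
  have /choice[Dm HD] : forall K : midx, exists Dm : R, 0 <= Dm /\
    forall h, cabs h <= 1 ->
    cabs (mpow (shift_at j h w) K - mpow w K - h * dmpow j w K) <= Dm * cabs h ^+ 2.
    by move=> K; have [Dm ? ?] := mpow_second_order j w K; exists Dm.
  by exists Dm => K; case: (HD K).
pose E := \sum_(K <- A) cabs (a K) * Dm K.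
have E0 : 0 <= E by apply: sumr_ge0 => K _; rewrite mulr_ge0 ?cabs_ge0.
have M0 : 0 < 4 * (C + E + 1) by lra.
pose x := Num.min (Num.min (delta / 2) 1) (Num.min g (e / (4 * (C + E + 1)))).
have x0 : 0 < x.
  by rewrite !lt_min ltr01 g0 !divr_gt0.
have [xd x1 xg xe] : [/\ x < delta, x <= 1, x <= g & x * (4 * (C + E + 1)) <= e].
  have : x <= x by []. rewrite {2}/x !le_min => /andP[/andP[? ->] /andP[-> H]].
  split=> //; first by lra.
  by rewrite -ler_pdivlMr.
pose h : Cplx R := x%:C.
have hx : cabs h = x by rewrite cabs_real gtr0_norm.
have hn0 : h != 0 by rewrite -cabs_gt0 hx.
set S := \sum_(K <- A) a K * dmpow j w K.
pose S1 := \sum_(K <- A) a K * (mpow (shift_at j h w) K - mpow w K).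
(* three errors, each small against x: the quotient against d, the omitted
   terms, and the increments of the retained ones against their derivatives *)
have err1 := Hd h; rewrite hx in err1; have {}err1 := err1 xd.
have err2 : cabs (F (z + h *: e_ j) - F z - S1) <= x * (e / 4).
  pose f (K : midx) := a K * (mpow (shift_at j h w) K - mpow w K).
  apply: (@totally_sum_le _ _ f) => [|A' AA'].
    pose f1 K := a K * mpow (shift_at j h w) K.
    pose f2 K := a K * mpow w K.
    have c1 : partial_sum f1 @ totally --> F (z + h *: e_ j).
      case: (Fz0) => _ /(_ (z + h *: e_ j)); rewrite /f1.
      have -> : (fun K : midx =>
          a K * mpow (fun k => (z + h *: e_ j) ord0 k - z0 ord0 k) K) = f1.
        apply: funext => K; rewrite /f1; congr (_ * _); apply: eq_bigr => k _.
        by rewrite shiftE /shift_at addrAC.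
      apply => k; rewrite shiftE addrAC; apply: le_lt_trans (cabsD _ _) _.
      have := wr k; have : cabs (if k == j then h else 0) <= g.
        by case: ifP => _; rewrite ?hx ?cabs0// ltW.
      by rewrite /g /w; lra.
    have c2 : partial_sum f2 @ totally --> F z by case: Fz0 => _; apply.
    move/totally_sumP: c1 => c1; move/totally_sumP: c2 => c2.
    apply/totally_sumP => u u0.
    have [A1 HA1] := c1 _ (divr_gt0 u0 (ltr0n _ 2)).
    have [A2 HA2] := c2 _ (divr_gt0 u0 (ltr0n _ 2)).
    exists (A1 `|` A2)%fset => A'; rewrite fsubUset => /andP[A1' A2'].
    have -> : \sum_(K <- A') f K = \sum_(K <- A') f1 K - \sum_(K <- A') f2 K.
      by rewrite -sumrB; apply: eq_bigr => K _; rewrite /f mulrBr.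
    have -> (p1 p2 q1 q2 : Cplx R) : p1 - p2 - (q1 - q2) = (p1 - q1) - (p2 - q2) by ring.
    apply: le_lt_trans (cabsB _ _) _.
    by have := HA1 _ A1'; have := HA2 _ A2'; lra.
  apply: (@le_trans _ _ (\sum_(K <- (A' `\` A)%fset) x * tail K)).
    by apply: ler_sum => K _; have := @inc h K; rewrite hx; apply.
  rewrite -mulr_sumr ler_wpM2l ?(ltW x0)// HA0//.
  apply/fdisjointP => K KA0; rewrite inE negb_and negbK.
  by rewrite (fsubsetP A0A).
have err3 : cabs (S1 - h * S) <= E * x ^+ 2.
  rewrite /S1 /S mulr_sumr -sumrB /E mulr_suml.
  apply: le_trans (cabs_sum _ _ _) _; apply: ler_sum => K _.
  have -> : a K * (mpow (shift_at j h w) K - mpow w K) - h * (a K * dmpow j w K) =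
    a K * (mpow (shift_at j h w) K - mpow w K - h * dmpow j w K) by ring.
  rewrite cabsM -mulrA ler_wpM2l ?cabs_ge0//.
  by rewrite -hx; apply: HDm; rewrite hx.
have tot : x * cabs (d - S) <= C * x ^+ 2 + x * (e / 4) + E * x ^+ 2.
  rewrite -[X in X * cabs _]hx -cabsM.
  set Q := F (z + h *: e_ j) - F z in err1 err2.
  have -> : h * (d - S) = (Q - S1) - (Q - h * d) + (S1 - h * S) by ring.
  apply: le_trans (cabsD _ _) _; apply: lerD => //.
  apply: le_trans (cabsB _ _) _; rewrite addrC; exact: lerD.
have : x * cabs (d - S) <= x * (e / 2).
  apply: le_trans tot _.
  rewrite (_ : _ + _ + _ = x * ((C + E) * x + e / 4)); last by ring.
  by rewrite ler_wpM2l ?(ltW x0)//; nra.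
by rewrite ler_pM2l//; lra.
Qed.

Lemma succ_at_inj j : injective (@succ_at n j).
Proof.
move=> K K' /ffunP H; apply/ffunP => i; have := H i; rewrite !ffunE.
by case: eqP => // _ [].
Qed.

(** The terms free of the variable vanish under differentiation, so shifting
    the index by one turns termwise derivatives into a power series. *)
Lemma reindex_derivative (a : midx -> Cplx R) (w : 'I_n -> Cplx R) j (d : Cplx R) :
  partial_sum (fun K : midx => a K * dmpow j w K) @ totally --> d ->
  partial_sum (fun K : midx => ((K j).+1)%:R * a (succ_at j K) * mpow w K)
    @ totally --> d.
Proof.
move=> /totally_sumP H; apply/totally_sumP => e e0.
have [A0 HA0] := H _ e0.
pose pred_at (K : midx) : midx := [ffun i => if i == j then (K i).-1 else K i].
exists [fset pred_at K | K in A0]%fset => A A0A.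
pose SA := [fset succ_at j K | K in A]%fset.
have := HA0 _ (fsubsetUl A0 SA).
rewrite (@sum_fsetD _ _ SA) ?fsubsetUr//.
rewrite [X in _ - (_ + X)](_ : _ = 0) ?addr0; last first.
  rewrite big_seq big1// => K; rewrite inE => /andP[KS].
  rewrite inE (negbTE KS) orbF => KA0.
  rewrite /dmpow; case E: (K j) => [|k]; first by rewrite !mul0r mulr0.
  case/negP: KS; apply/imfsetP; exists (pred_at K) => /=.
    by apply: (fsubsetP A0A); apply/imfsetP; exists K.
  by apply/ffunP => i; rewrite !ffunE; case: eqP => [->|//]; rewrite E.
rewrite big_imfset/=; last by move=> K K' _ _ /succ_at_inj.
rewrite (_ : \sum_(K <- A) a (succ_at j K) * _ =
   \sum_(K <- A) ((K j).+1)%:R * a (succ_at j K) * mpow w K)//.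
apply: eq_bigr => K _; rewrite /dmpow ffunE eqxx [mpow _ _](mpowD1 j).
have -> : mpow_off j w (succ_at j K) = mpow_off j w K.
  by apply: eq_bigr => k /negbTE kj; rewrite ffunE kj.
by rewrite /=; ring.
Qed.

Lemma cnorm_ge z k : cabs (z ord0 k) <= cnorm z.
Proof.
rewrite /cnorm -(ler_pXn2r (n := 2)) ?nnegrE ?cabs_ge0 ?sqrtr_ge0//.
rewrite sqr_sqrtr; last by apply: sumr_ge0 => *; exact: sqr_ge0.
by rewrite (bigD1 k)//= lerDl sumr_ge0// => *; exact: sqr_ge0.
Qed.

Lemma unit_ballE z : unit_ball z <-> \sum_k cabs (z ord0 k) ^+ 2 < 1.
Proof.
rewrite /unit_ball/= /cnorm; set S := \sum_k _.
have S0 : 0 <= S by apply: sumr_ge0 => *; exact: sqr_ge0.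
split=> H.
  rewrite -(sqr_sqrtr S0) -[ltRHS](expr1n _ 2).
  by rewrite ltrXn2r ?nnegrE ?sqrtr_ge0.
by rewrite -sqrtr1 ltr_sqrt.
Qed.

Lemma unit_ball_polydisc z0 : unit_ball z0 -> exists2 rho, 0 < rho &
  forall z, (forall k, cabs (z ord0 k - z0 ord0 k) < rho) -> unit_ball z.
Proof.
move=> zB; have z1 k := le_lt_trans (cnorm_ge z0 k) zB.
move/unit_ballE: zB; set S := \sum_k _ => S1.
pose rho := Num.min 1 ((1 - S) / (3 * (n%:R + 1))).
have n1 : 0 < 3 * (n%:R + 1) :> R by rewrite mulr_gt0// ltr_wpDl.
have r0 : 0 < rho by rewrite lt_min ltr01 divr_gt0// subr_gt0.
exists rho => // z zr; apply/unit_ballE.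
have [r1 r2] : rho <= 1 /\ rho * (3 * (n%:R + 1)) <= 1 - S.
  by rewrite -ler_pdivlMr//; have : rho <= rho by []; rewrite {2}/rho le_min => /andP.
have le k : cabs (z ord0 k) ^+ 2 <= cabs (z0 ord0 k) ^+ 2 + 3 * rho.
  have : cabs (z ord0 k) <= cabs (z0 ord0 k) + rho.
    have -> : z ord0 k = z0 ord0 k + (z ord0 k - z0 ord0 k) by ring.
    by apply: le_trans (cabsD _ _) _; rewrite lerD2l ltW.
  have := z1 k; have := cabs_ge0 (z ord0 k); have := cabs_ge0 (z0 ord0 k).
  by nra.
apply: le_lt_trans (ler_sum _ (fun k _ => le k)) _.
rewrite big_split/= sumr_const card_ord -/S -mulr_natr.
by have : 0 < rho by []; nra.
Qed.

Lemma analytic_expansion F z0 : analytic_on_ball F -> unit_ball z0 ->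
  exists a rho, expansion F z0 a rho.
Proof. by move=> H /H. Qed.

Lemma analytic_second_order F z j : analytic_on_ball F -> unit_ball z ->
  exists C delta, [/\ 0 <= C, 0 < delta & forall h, cabs h < delta ->
    cabs (F (z + h *: e_ j) - F z - h * pderiv j F z) <= C * cabs h ^+ 2].
Proof.
move=> aF zB; have [a [rho Fz]] := analytic_expansion aF zB.
have [C [d H]] := center_second_order j Fz.
rewrite (@derive_second_order _ _ F z j (a (axis j 1))); last by exists C, d.
by exists C, d.
Qed.

Lemma pderiv_expansion F z0 a rho j : analytic_on_ball F -> unit_ball z0 ->
  expansion F z0 a rho -> exists rho', expansion (pderiv j F) z0
    (fun K => ((K j).+1)%:R * a (succ_at j K)) rho'.
Proof.
move=> aF zB Fz0; have rho0 : 0 < rho by case: Fz0.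
have [rho1 rho10 H1] := unit_ball_polydisc zB.
exists (Num.min rho rho1); split=> [|z zr]; first by rewrite lt_min rho0.
apply: (@reindex_derivative a (fun k => z ord0 k - z0 ord0 k)).
apply: (termwise_derivative Fz0) => [k|].
  by have := zr k; rewrite lt_min => /andP[].
apply: analytic_second_order => //; apply: H1 => k.
by have := zr k; rewrite lt_min => /andP[].
Qed.

Lemma analytic_pderiv F j : analytic_on_ball F -> analytic_on_ball (pderiv j F).
Proof.
move=> aF z0 zB; have [a [rho H]] := analytic_expansion aF zB.
have [rho' H'] := pderiv_expansion j aF zB H.
by exists (fun K : midx => ((K j).+1)%:R * a (succ_at j K)), rho'.
Qed.

Lemma pderiv_center F z0 a rho j : expansion F z0 a rho ->
  pderiv j F z0 = a (axis j 1).
Proof. by move=> H; apply: derive_second_order; exact: center_second_order H. Qed.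

(** At the centre both sides read off the coefficient of [z_i * z_j]. *)
Lemma pderivC F i j z : analytic_on_ball F -> unit_ball z ->
  pderiv i (pderiv j F) z = pderiv j (pderiv i F) z.
Proof.
move=> aF zB; have [->//|ij] := eqVneq i j.
have [a [rho H]] := analytic_expansion aF zB.
have [r1 H1] := pderiv_expansion j aF zB H.
have [r2 H2] := pderiv_expansion i aF zB H.
rewrite (pderiv_center i H1) (pderiv_center j H2) !ffunE (negbTE ij) eq_sym (negbTE ij).
congr (_ * a _); apply/ffunP => k; rewrite !ffunE.
by case: (k == j); case: (k == i).
Qed.

(** The ball being open, a derivative at one of its points depends only on
    the values inside. *)
Lemma eq_pderiv F G j z : (forall y, unit_ball y -> F y = G y) -> unit_ball z ->
  analytic_on_ball F -> pderiv j F z = pderiv j G z.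
Proof.
move=> FG zB aF; have [C [d [C0 d0 H]]] := analytic_second_order j aF zB.
have [rho rho0 H1] := unit_ball_polydisc zB.
symmetry; apply: derive_second_order; exists C, (Num.min d rho).
split => //; first by rewrite lt_min d0.
move=> h; rewrite lt_min => /andP[hd hr]; rewrite -!FG ?H//.
apply: H1 => k; rewrite shiftE addrAC subrr add0r.
by case: ifP => _; rewrite ?cabs0.
Qed.

Lemma analytic_iter_pderiv F j k : analytic_on_ball F ->
  analytic_on_ball (iter k (pderiv j) F).
Proof.
move=> aF; elim: k => [|k IH]; first exact: aF.
by rewrite iterS; exact: analytic_pderiv IH.
Qed.

Lemma iter_pderivC F i j k z : analytic_on_ball F -> unit_ball z ->
  pderiv i (iter k (pderiv j) F) z = iter k (pderiv j) (pderiv i F) z.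
Proof.
move=> aF; elim: k z => [|k IH] z zB; first by [].
have aI := analytic_iter_pderiv j k aF.
rewrite !iterS (pderivC i j aI zB).
exact: (eq_pderiv j IH zB (analytic_pderiv i aI)).
Qed.

Definition foldr_deriv (s : seq 'I_n) (K : 'I_n -> nat) F :=
  foldr (fun j G => iter (K j) (pderiv j) G) F s.

Lemma analytic_foldr_deriv s K F : analytic_on_ball F ->
  analytic_on_ball (foldr_deriv s K F).
Proof.
move=> aF; elim: s => [|j s IH]; first exact: aF.
exact: analytic_iter_pderiv IH.
Qed.

Lemma analytic_mderiv K F : analytic_on_ball F -> analytic_on_ball (mderiv K F).
Proof. exact: analytic_foldr_deriv. Qed.

Definition addone (K : 'I_n -> nat) (j : 'I_n) : 'I_n -> nat := fun i => (K i + (i == j))%N.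

Lemma eq_iter_pderiv F G j k z : (forall y, unit_ball y -> F y = G y) -> unit_ball z ->
  analytic_on_ball F -> iter k (pderiv j) F z = iter k (pderiv j) G z.
Proof.
move=> FG + aF; elim: k z => [|k IH] z zB; first exact: FG.
exact: (eq_pderiv j IH zB (analytic_iter_pderiv j k aF)).
Qed.

(** [mderiv] differentiates in a fixed order; partial derivatives commute, so
    one more derivative may be taken outermost. *)
Lemma pderiv_mderiv K F j z : analytic_on_ball F -> unit_ball z ->
  pderiv j (mderiv K F) z = mderiv (addone K j) F z.
Proof.
move=> aF zB; suff H (s : seq 'I_n) x : uniq s -> unit_ball x ->
    foldr_deriv s (addone K j) F x =
    (if j \in s then pderiv j (foldr_deriv s K F) x else foldr_deriv s K F x).
  by have := H _ z (enum_uniq 'I_n) zB; rewrite mem_enum => /esym.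
elim: s x => [//|i s IH] x /andP[is_ us] xB; rewrite inE.
have aK := analytic_foldr_deriv s K aF.
have aK' := analytic_foldr_deriv s (addone K j) aF.
have eqs (y : vec) : unit_ball y -> foldr_deriv s (addone K j) F y =
    if j \in s then pderiv j (foldr_deriv s K F) y else foldr_deriv s K F y.
  exact: IH.
have step k : addone K j i = k -> foldr_deriv (i :: s) (addone K j) F x =
    iter k (pderiv i) (foldr_deriv s (addone K j) F) x.
  by move=> <-.
have [ji|ij] := eqVneq j i.
  subst i; rewrite (negbTE is_) in eqs.
  have aKj : addone K j j = (K j).+1 by rewrite /addone eqxx addn1.
  refine (etrans (step _ aKj) _).
  refine (etrans (@eq_iter_pderiv _ _ j (K j).+1 x eqs xB aK') _).
  exact: erefl.
have aKi : addone K j i = K i by rewrite /addone eq_sym (negbTE ij) addn0.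
refine (etrans (step _ aKi) _).
refine (etrans (@eq_iter_pderiv _ _ i (K i) x eqs xB aK') _).
case: (j \in s); last by [].
exact: (esym (iter_pderivC j i (K i) aK xB)).
Qed.

End DerivativeExpansion.

(** * Complex-valued functions of a real variable *)

Section RealPaths.
Variable R : realType.
Implicit Types (f : R -> Cplx R) (t u : R).

(** Differentiability as an explicit estimate, the form in which the radial
    derivatives of analytic functions are available. *)
Definition cderiv f t (d : Cplx R) : Prop := forall e, 0 < e ->
  exists2 delta, 0 < delta & forall h : R, `|h| < delta ->
    cabs (f (t + h) - f t - h%:C * d) <= e * `|h|.

Lemma cderiv_scale f t d a : cderiv f t d -> cderiv (fun u => a * f u) t (a * d).
Proof.
move=> H e e0; have a1 : 0 < cabs a + 1 by rewrite ltr_wpDl// cabs_ge0.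
have [del del0 Hd] := H _ (divr_gt0 e0 a1); exists del => // h hd.
have -> : a * f (t + h) - a * f t - h%:C * (a * d) = a * (f (t + h) - f t - h%:C * d).
  by move: (f _) (f _) (real_complex _ _) => *; ring.
rewrite cabsM; apply: le_trans (ler_wpM2l (cabs_ge0 a) (Hd _ hd)) _.
rewrite mulrA ler_wpM2r// mulrCA ler_piMr ?(ltW e0)// ler_pdivrMr// mul1r.
by rewrite lerDl.
Qed.

Lemma real_is_derive (g : R -> R) t d :
  (forall e, 0 < e -> exists2 delta, 0 < delta & forall h, `|h| < delta ->
    `|g (t + h) - g t - h * d| <= e * `|h|) -> is_derive t 1 g d.
Proof.
move=> H.
have C : h^-1 *: ((g \o shift t) (h *: (1 : R)) - g t) @[h --> 0^'] --> d.
  apply/cvgrPdist_le => e e0; have [del del0 Hd] := H _ e0.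
  near=> h.
  have hn0 : h != 0 by near: h; exact: nbhs_dnbhs_neq.
  have hd : `|h| < del.
    near: h; apply: dnbhs0_lt => //.
  rewrite /= (addrC _ t) scaler1.
  have -> : d - h^-1 *: (g (t + h) - g t) = - (h^-1 * (g (t + h) - g t - h * d)).
    by rewrite mulrBr mulrA mulVf// mul1r opprB.
  rewrite normrN normrM normfV mulrC ler_pdivrMr ?normr_gt0//.
  exact: Hd.
by split; [apply/cvg_ex; exists d|exact: cvg_lim].
Unshelve. all: by end_near. Qed.

Lemma cderiv_Re f t d : cderiv f t d ->
  is_derive t 1 (fun u => complex.Re (f u)) (complex.Re d).
Proof.
move=> H; apply: real_is_derive => e e0; have [del del0 Hd] := H _ e0.
exists del => // h hd; apply: le_trans (Hd _ hd).
apply: le_trans (Re_le_cabs _).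
by case: (f (t + h)) (f t) d {H Hd} => [a b] [a' b'] [a'' b'']/=; rewrite mul0r subr0.
Qed.

Lemma cderiv_Im f t d : cderiv f t d ->
  is_derive t 1 (fun u => complex.Im (f u)) (complex.Im d).
Proof.
move=> H; apply: real_is_derive => e e0; have [del del0 Hd] := H _ e0.
exists del => // h hd; apply: le_trans (Hd _ hd).
apply: le_trans (Im_le_cabs _).
by case: (f (t + h)) (f t) d {H Hd} => [a b] [a' b'] [a'' b'']/=; rewrite mul0r addr0.
Qed.

Lemma derive_continuous_within (g dg : R -> R) (a b : R) :
  (forall t, t \in `[a, b]%R -> is_derive t 1 g (dg t)) ->
  {within `[a, b], continuous g}.
Proof.
move=> H; apply: continuous_in_subspaceT => t /[!inE]/= tab.
have {}H := H t tab.
by apply: differentiable_continuous; apply/derivable1_diffP.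
Qed.

(** The factor 2 comes from treating real and imaginary parts separately. *)
Lemma cderiv_mean_value f f' (a b M : R) : a <= b ->
  (forall t, t \in `[a, b]%R -> cderiv f t (f' t)) ->
  (forall t, t \in `[a, b]%R -> cabs (f' t) <= M) ->
  cabs (f b - f a) <= 2 * M * (b - a).
Proof.
move=> ab df fM.
have one (p : Cplx R -> R) : (forall z, `|p z| <= cabs z) ->
    (forall t, t \in `[a, b]%R -> is_derive t 1 (fun u => p (f u)) (p (f' t))) ->
    `|p (f b) - p (f a)| <= M * (b - a).
  move=> pc dp.
  pose g u := p (f u); pose dg u := p (f' u).
  have dg_oo t : t \in `]a, b[%R -> is_derive t 1 g (dg t).
    by move=> tab; apply: dp; exact: (subset_itv_oo_cc tab).
  have [c cab E] := MVT_segment ab dg_oo (derive_continuous_within dp).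
  rewrite -/(g b) -/(g a) E /dg.
  rewrite normrM (@ger0_norm _ (b - a)) ?subr_ge0// ler_wpM2r ?subr_ge0//.
  exact: le_trans (pc _) (fM _ cab).
apply: le_trans (cabs_le_ReIm _) _.
have := one _ (@Re_le_cabs R) (fun t tab => cderiv_Re (df t tab)).
have := one _ (@Im_le_cabs R) (fun t tab => cderiv_Im (df t tab)).
case: (f b) (f a) => [x y] [x' y'] /=; lra.
Qed.

Lemma cderiv_cabs_bounded f f' (a b : R) : a <= b ->
  (forall t, t \in `[a, b]%R -> cderiv f t (f' t)) ->
  exists B, forall t, t \in `[a, b]%R -> cabs (f t) <= B.
Proof.
move=> ab df.
have c1 := derive_continuous_within (fun t tab => cderiv_Re (df t tab)).
have c2 := derive_continuous_within (fun t tab => cderiv_Im (df t tab)).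
have bnd (g : R -> R) : {within `[a, b], continuous g} ->
    exists B, forall t, t \in `[a, b]%R -> `|g t| <= B.
  move=> cg; have [t1 _ H1] := EVT_max ab cg; have [t2 _ H2] := EVT_min ab cg.
  exists (`|g t1| + `|g t2|) => t tab; have := H1 _ tab; have := H2 _ tab.
  move: (g t) (g t1) (g t2) => x y z xz xy; rewrite ler_norml.
  have := ler_norm y; have := ler_norm (- z); rewrite normrN.
  by have := normr_ge0 y; have := normr_ge0 z; lra.
have [B1 H1] := bnd _ c1; have [B2 H2] := bnd _ c2.
exists (B1 + B2) => t tab; apply: le_trans (cabs_le_ReIm _) _.
by apply: lerD; [exact: H1|exact: H2].
Qed.

(** A system whose derivatives are controlled by its own largest member cannot
    more than double over a short interval: let [S] be the supremum of all
    members; the mean value inequality gives [S <= S0 + S / 2]. *)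
Lemma short_interval_growth (I : finType) (P : pred I) (phi phi' : I -> R -> Cplx R)
    (a b kappa S0 : R) : a <= b -> 0 <= kappa -> 4 * kappa * (b - a) <= 1 ->
  (forall i t, P i -> t \in `[a, b]%R -> cderiv (phi i) t (phi' i t)) ->
  (forall i t S, P i -> t \in `[a, b]%R -> (forall k, P k -> cabs (phi k t) <= S) ->
     cabs (phi' i t) <= kappa * S) ->
  0 <= S0 -> (forall i, P i -> cabs (phi i a) <= S0) ->
  forall i t, P i -> t \in `[a, b]%R -> cabs (phi i t) <= 2 * S0.
Proof.
move=> ab k0 kab dphi bphi S00 init.
move=> i0 t0 Pi0 t0ab.
pose V : set R := [set x | exists i t, [/\ P i, t \in `[a, b]%R & x = cabs (phi i t)]].
have V0 : V !=set0 by exists (cabs (phi i0 t0)), i0, t0.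
have /choice[B HB] : forall i, exists B, P i ->
    forall t, t \in `[a, b]%R -> cabs (phi i t) <= B.
  move=> i; case Pi: (P i); last by exists 0.
  have [B HB] := cderiv_cabs_bounded ab (fun t => dphi i t Pi).
  by exists B.
have hV : has_sup V.
  split=> //; exists (\big[Num.max/0]_i B i) => _ [i [t [Pi tab ->]]].
  by apply: le_trans (HB i Pi t tab) _; exact: le_bigmax.
have ub i t : P i -> t \in `[a, b]%R -> cabs (phi i t) <= sup V.
  by move=> Pi tab; apply: sup_upper_bound => //; exists i, t.
have S_half : sup V <= S0 + sup V / 2.
  apply: ge_sup => // _ [i [t [Pi tab ->]]].
  have S0' : 0 <= sup V by apply: le_trans (ub _ _ Pi tab); exact: cabs_ge0.
  move: (tab); rewrite in_itv/= => /andP[a_t t_b].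
  have sub u : u \in `[a, t]%R -> u \in `[a, b]%R.
    by rewrite !in_itv/= => /andP[-> /le_trans]; apply.
  have mv : cabs (phi i t - phi i a) <= 2 * (kappa * sup V) * (t - a).
    apply: (cderiv_mean_value (f' := phi' i)) => // u ut.
      by apply: dphi => //; exact: sub.
    by apply: bphi => //; [exact: sub|move=> k Pk; apply: ub => //; exact: sub].
  have le1 : 2 * (kappa * sup V) * (t - a) <= sup V / 2.
    have : 4 * kappa * (t - a) <= 1.
      apply: le_trans kab; rewrite ler_wpM2l ?mulr_ge0// lerB//.
    by move=> H; have := ler_wpM2r S0' H; lra.
  have -> : phi i t = phi i a + (phi i t - phi i a) by ring.
  apply: le_trans (cabsD _ _) _; apply: lerD; [exact: init|exact: le_trans mv le1].
by apply: le_trans (ub _ _ Pi0 t0ab) _; lra.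
Qed.

End RealPaths.

(** * Radial coordinates *)

Section Radial.
Variables (R : realType) (n : nat).
Local Notation vec := 'rV[Cplx R]_n.
Implicit Types (x y theta : 'rV[R]_n) (j k : 'I_n) (F : vec -> Cplx R).

Definition upd (T : Type) (x : 'rV[T]_n) j (t : T) : 'rV[T]_n :=
  \row_k (if k == j then t else x ord0 k).

Lemma updE (T : Type) (x : 'rV[T]_n) j t k :
  upd x j t ord0 k = if k == j then t else x ord0 k.
Proof. by rewrite mxE. Qed.

Lemma upd_id (T : Type) (x : 'rV[T]_n) j : upd x j (x ord0 j) = x.
Proof. by apply/rowP => k; rewrite mxE; case: eqP => [->|]. Qed.

Lemma upd_upd (T : Type) (x : 'rV[T]_n) j t u : upd (upd x j t) j u = upd x j u.
Proof. by apply/rowP => k; rewrite !mxE; case: eqP. Qed.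

Definition direction theta j : Cplx R :=
  cos (theta ord0 j) +i* sin (theta ord0 j).

Lemma cabs_direction theta j : cabs (direction theta j) = 1.
Proof. by rewrite /cabs/= cos2Dsin2 sqrtr1. Qed.

Lemma polarE x theta k : polar x theta ord0 k = (x ord0 k)%:C * direction theta k.
Proof. by rewrite mxE; congr Complex => /=; rewrite mul0r ?subr0 ?addr0. Qed.

Lemma cabs_polar x theta k : cabs (polar x theta ord0 k) = `|x ord0 k|.
Proof. by rewrite polarE cabsM cabs_direction mulr1 cabs_real. Qed.

Lemma cabs_polarB x y theta k :
  cabs (polar x theta ord0 k - polar y theta ord0 k) = `|x ord0 k - y ord0 k|.
Proof.
by rewrite !polarE -mulrBl cabsM cabs_direction mulr1 -rmorphB cabs_real.
Qed.

Lemma polar_upd x theta j t h : polar (upd x j (t + h)) theta =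
  polar (upd x j t) theta + (h%:C * direction theta j) *: (delta_mx ord0 j : vec).
Proof.
apply/rowP => k; rewrite shiftE !polarE !updE.
case: eqP => [->|_]; last by rewrite addr0.
by rewrite rmorphD/= mulrDl.
Qed.

Lemma cnorm_polar x theta : cnorm (polar x theta) = rnorm x.
Proof.
by congr Num.sqrt; apply: eq_bigr => k _; rewrite cabs_polar real_normK ?num_real.
Qed.

Lemma unit_ball_polar x theta : unit_ball (polar x theta) = (rnorm x < 1) :> Prop.
Proof. by rewrite /unit_ball/= cnorm_polar. Qed.

Lemma rnorm_le x y : (forall k, `|y ord0 k| <= `|x ord0 k|) -> rnorm y <= rnorm x.
Proof.
move=> yx; apply: ler_wsqrtr; apply: ler_sum => k _.
by rewrite -(real_normK (num_real (y _ _))) -(real_normK (num_real (x _ _)))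
  lerXn2r ?nnegrE.
Qed.

Lemma rnorm_upd_lt1 x j (a b t : R) : 0 <= a -> a <= t <= b ->
  rnorm (upd x j b) < 1 -> rnorm (upd x j t) < 1.
Proof.
move=> a0 /andP[at_ tb]; apply: le_lt_trans; apply: rnorm_le => k.
by rewrite !updE; case: eqP => // _; rewrite !ger0_norm//; lra.
Qed.

Lemma rnorm_segment x j (t u : R) : 0 <= x ord0 j -> 0 <= t -> rnorm x < 1 ->
  rnorm (upd x j t) < 1 -> 0 <= u <= 1 ->
  rnorm (upd x j (x ord0 j + u * (t - x ord0 j))) < 1.
Proof.
move=> x0 t0 xB tB /andP[u0 u1].
have [xt|tx] := leP (x ord0 j) t.
  apply: (@rnorm_upd_lt1 _ _ 0 t) => //; apply/andP; split; nra.
rewrite -[x in rnorm x < 1](upd_id x j) in xB.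
apply: (@rnorm_upd_lt1 _ _ 0 (x ord0 j)) => //; apply/andP; split; nra.
Qed.

Lemma radial_cderiv F x theta j t0 s u : analytic_on_ball F ->
  rnorm (upd x j (t0 + u * s)) < 1 ->
  cderiv (fun u => F (polar (upd x j (t0 + u * s)) theta)) u
    (s%:C * direction theta j *
       pderiv j F (polar (upd x j (t0 + u * s)) theta)).
Proof.
move=> aF; rewrite -(unit_ball_polar _ theta) => zB e e0.
have [C [d [C0 d0 H]]] := analytic_second_order j aF zB.
set z := polar _ theta in H zB *.
have s1 : 0 < `|s| + 1 by rewrite ltr_wpDl.
pose D := C * (`|s| + 1) ^+ 2 + 1.
have D0 : 0 < D by rewrite ltr_wpDl// mulr_ge0// exprn_ge0// ltW.
exists (Num.min (d / (`|s| + 1)) (e / D)).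
  by rewrite lt_min !divr_gt0.
move=> h; rewrite lt_min !ltr_pdivlMr// => /andP[hd he].
have -> : t0 + (u + h) * s = t0 + u * s + h * s by ring.
rewrite polar_upd -/z.
have cs : cabs ((h * s)%:C * direction theta j) = `|h| * `|s|.
  by rewrite cabsM cabs_direction mulr1 cabs_real normrM.
have := H ((h * s)%:C * direction theta j); rewrite cs => /(_ _).
have h0 := normr_ge0 h; have s0 := normr_ge0 s.
have lt : `|h| * `|s| < d by nra.
move=> /(_ lt) H1.
rewrite [X in _ - X](_ : _ = (h * s)%:C * direction theta j * pderiv j F z).
  2: by rewrite rmorphM/=; ring.
apply: le_trans H1 _.
have : C * (`|h| * `|s|) ^+ 2 <= (`|h| * D) * `|h|.
  rewrite exprMn /D; have : `|s| ^+ 2 <= (`|s| + 1) ^+ 2 by nra.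
  have hh : 0 <= `|h| ^+ 2 by exact: sqr_ge0.
  move=> ss; have : C * `|s| ^+ 2 <= C * (`|s| + 1) ^+ 2 by rewrite ler_wpM2l.
  rewrite !expr2 in hh *; nra.
by move=> /le_trans; apply; rewrite ler_wpM2r// ltW.
Qed.

Lemma mpow_le (a b : 'I_n -> R) (Lam : R) m (K : 'I_n -> nat) :
  1 <= Lam -> (forall k, 0 <= a k) -> (forall k, a k <= Lam * b k) ->
  (mdeg K <= m)%N -> mpow a K <= Lam ^+ m * mpow b K.
Proof.
move=> L1 a0 ab Km; have L0 : 0 < Lam by lra.
have b0 k : 0 <= b k by have := le_trans (a0 k) (ab k); rewrite pmulr_rge0.
apply: (@le_trans _ _ (mpow (fun k => Lam * b k) K)).
  by apply: ler_prod => k _; rewrite exprn_ge0//= lerXn2r ?nnegrE ?mulr_ge0 ?(ltW L0).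
have -> : mpow (fun k => Lam * b k) K = Lam ^+ mdeg K * mpow b K.
  by rewrite -mpow_const -big_split/=; apply: eq_bigr => k _; rewrite exprMn.
by rewrite ler_wpM2r ?prodr_ge0// ?ler_weXn2l// => k _; exact: exprn_ge0.
Qed.

Lemma mpow_addone (a : 'I_n -> R) K j : mpow a (addone K j) = a j * mpow a K.
Proof.
rewrite /mpow (bigD1 j)//= [in RHS](bigD1 j)//= /addone eqxx addn1 exprS mulrA.
by congr (_ * _); apply: eq_bigr => k /negbTE ->; rewrite addn0.
Qed.

Lemma mdeg_addone K j : mdeg (addone K j) = (mdeg K).+1.
Proof.
rewrite (mdegD1 _ j) (mdegD1 K j) /addone eqxx addn1 addSn; congr (_ + _).+1.
by apply: eq_bigr => k /negbTE ->; rewrite addn0.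
Qed.

Lemma mfact_addone K j : mfact (addone K j) = ((K j).+1 * mfact K)%N.
Proof.
rewrite /mfact (bigD1 j)//= [in RHS](bigD1 j)//= /addone eqxx addn1 factS mulnA.
by congr (_ * _)%N; apply: eq_bigr => k /negbTE ->; rewrite addn0.
Qed.

Lemma mfact_gt0 (K : 'I_n -> nat) : (0 < mfact K)%N.
Proof. by apply: prodn_gt0 => k; exact: fact_gt0. Qed.

Lemma le_mdeg (K : 'I_n -> nat) j : (K j <= mdeg K)%N.
Proof. by rewrite (mdegD1 K j) leq_addr. Qed.

End Radial.

(** * Consequences of the conditions on L *)

Section LocalScale.
Variables (R : realType) (n : nat) (beta c : R).
Variable L : 'I_n -> 'rV[Cplx R]_n -> R.

Definition locally_comparable (Lam : R) := 1 <= Lam /\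
  forall (z0 z : 'rV[Cplx R]_n) j, unit_ball z0 ->
    (forall k, cabs (z ord0 k - z0 ord0 k) <= 1 / L k z0) ->
    L j z <= Lam * L j z0 /\ L j z0 <= Lam * L j z.

Lemma class_Q_ge1 : Num.sqrt n%:R < beta -> class_Q beta L ->
  forall j (z : 'rV[Cplx R]_n), unit_ball z -> 1 <= L j z.
Proof.
move=> nb [_ _ H _] j z zB; apply: ltW; apply: le_lt_trans (H j z zB).
have n1 : 1 <= Num.sqrt n%:R :> R.
  rewrite -[leLHS]sqrtr1 ler_wsqrtr// ler1n; exact: leq_ltn_trans (leq0n j) (ltn_ord j).
have z0 : 0 <= cnorm z by exact: sqrtr_ge0.
rewrite ler_pdivlMr ?subr_gt0// mul1r; move: nb n1; lra.
Qed.

(** This is the condition of [class_Q] for the polyradius (1, .., 1), whose norm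
    [sqrt n] is below [beta]. *)
Lemma class_Q_comparable : Num.sqrt n%:R < beta -> class_Q beta L ->
  exists Lam, locally_comparable Lam.
Proof.
move=> nb hQ; have L1 := class_Q_ge1 nb hQ; case: hQ => _ _ _ hQ.
pose r : 'rV[R]_n := const_mx 1.
have r0 : nonneg_vec r by move=> k; rewrite mxE.
have rb : rnorm r <= beta.
  rewrite /rnorm (eq_bigr (fun=> 1)) => [|k _]; last by rewrite mxE expr1n.
  by rewrite sumr_const card_ord ltW.
have /choice[M HM] : forall j, exists M : R, 1 <= M /\
    forall (z0 z : 'rV[Cplx R]_n), unit_ball z0 ->
    (forall k, cabs (z ord0 k - z0 ord0 k) <= 1 / L k z0) ->
    L j z <= M * L j z0 /\ L j z0 <= M * L j z.
  move=> j; have [l1 l12 l2] := hQ r r0 rb j.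
  have inr (z0 z : 'rV[Cplx R]_n) : unit_ball z0 ->
      (forall k, cabs (z ord0 k - z0 ord0 k) <= 1 / L k z0) ->
      local_ratios L j r (L j z / L j z0).
    move=> zB zz; exists z0, z; split => // k.
    by rewrite !mxE; exact: zz.
  have [e e0 He] : exists2 e : R, 0 < e & forall x, local_ratios L j r x -> e <= x.
    have lb x : local_ratios L j r x -> (lambda1 L j r <= x%:E)%E.
      by move=> Hx; apply: ereal_inf_lbound; exists x.
    move: l1 lb; case: (lambda1 L j r) => [v||] //.
      by rewrite lte_fin => v0 H; exists v => // x /H.
    by move=> _ H; exists 1 => // x /H.
  have [v Hv] : exists v : R, forall x, local_ratios L j r x -> x <= v.
    have ub x : local_ratios L j r x -> (x%:E <= lambda2 L j r)%E.
      by move=> Hx; apply: ereal_sup_ubound; exists x.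
    move: l2 ub; case: (lambda2 L j r) => [v||] //.
      by move=> _ H; exists v => x /H.
    by move=> _ H; exists 1 => // x /H.
  exists (Num.max 1 (Num.max v e^-1)); split; first by rewrite le_max lexx.
  move=> z0 z zB zz; have ratio := inr _ _ zB zz.
  have le1 := He _ ratio; have le2 := Hv _ ratio.
  have Lz0 : 0 < L j z0 by have := L1 j z0 zB; lra.
  move: le1 le2; rewrite ler_pdivlMr// ler_pdivrMr// => le1 le2.
  have Lz : 0 < L j z by apply: lt_le_trans le1; rewrite mulr_gt0.
  split.
    by apply: le_trans le2 _; rewrite ler_wpM2r ?(ltW Lz0)// !le_max lexx orbT.
  apply: (@le_trans _ _ (e^-1 * L j z)).
    by rewrite mulrC ler_pdivlMr// mulrC.
  by rewrite ler_wpM2r ?(ltW Lz)// !le_max lexx !orbT.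
exists (\big[Num.max/1]_j M j); split; first exact: bigmax_ge_id.
move=> z0 z j zB zz; have [M1 HMj] := HM j; have [le1 le2] := HMj _ _ zB zz.
have MM : M j <= \big[Num.max/1]_j M j by exact: le_bigmax.
have Lz0 : 0 < L j z0 by have := L1 j z0 zB; lra.
have Lz : 0 < L j z.
  rewrite -(pmulr_rgt0 _ (lt_le_trans ltr01 M1)); exact: lt_le_trans Lz0 le2.
split.
  by apply: le_trans le1 _; rewrite ler_wpM2r ?(ltW Lz0).
by apply: le_trans le2 _; rewrite ler_wpM2r ?(ltW Lz).
Qed.

Lemma class_K_torus : class_K beta c L -> forall r theta1 theta2 j,
  nonneg_vec r -> rnorm r < 1 -> angles theta1 -> angles theta2 ->
  L j (polar r theta2) <= c * L j (polar r theta1).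
Proof.
move=> [Lpos _ _ _ H] r t1 t2 j r0 rB a1 a2.
by rewrite -ler_pdivrMr ?Lpos ?unit_ball_polar// H.
Qed.

End LocalScale.

(** * Growth of the derivatives over one radial step *)

Section Growth.
Variables (R : realType) (n : nat) (L : 'I_n -> 'rV[Cplx R]_n -> R).
Variables (F : 'rV[Cplx R]_n -> Cplx R) (Lam : R) (m : nat).
Local Notation vec := 'rV[Cplx R]_n.
Implicit Types (x y theta : 'rV[R]_n) (j k : 'I_n).

Definition gmax (z : vec) : R :=
  \big[Num.max/0]_(K : {ffun 'I_n -> 'I_m.+1}
      | (mdeg (fun j => K j : nat) <= m)%N)
    norm_deriv L F z (fun j => K j : nat).

Hypothesis aF : analytic_on_ball F.
Hypothesis L_ge1 : forall j (z : vec), unit_ball z -> 1 <= L j z.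
Hypothesis L_comp : locally_comparable L Lam.
Hypothesis index_m : forall z : vec, unit_ball z -> forall J : 'I_n -> nat,
  norm_deriv L F z J <= gmax z.

Lemma L_gt0 j (z : vec) : unit_ball z -> 0 < L j z.
Proof. by move=> zB; apply: lt_le_trans (L_ge1 j zB). Qed.

Lemma Lam_ge1 : 1 <= Lam. Proof. by case: L_comp. Qed.

Lemma gmax_ge0 (z : vec) : 0 <= gmax z.
Proof. exact: bigmax_ge_id. Qed.

Lemma deriv_weight_gt0 (z : vec) (K : 'I_n -> nat) : unit_ball z ->
  0 < (mfact K)%:R * mpow (fun j => L j z) K.
Proof.
move=> zB; rewrite mulr_gt0 ?ltr0n ?mfact_gt0//.
by apply: prodr_gt0 => k _; rewrite exprn_gt0 ?L_gt0.
Qed.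

Lemma cabs_mderiv_le (z : vec) (J : 'I_n -> nat) : unit_ball z ->
  cabs (mderiv J F z) <= gmax z * ((mfact J)%:R * mpow (fun j => L j z) J).
Proof.
by move=> zB; rewrite -ler_pdivrMr ?deriv_weight_gt0//; exact: index_m.
Qed.

Lemma gmax_le (z : vec) (S : R) : 0 <= S ->
  (forall K : 'I_n -> nat, (mdeg K <= m)%N -> norm_deriv L F z K <= S) -> gmax z <= S.
Proof. by move=> S0 H; apply: bigmax_le => // K; exact: H. Qed.

Lemma mderiv0 : mderiv (fun=> 0%N) F = F.
Proof. by rewrite /mderiv; elim: (enum 'I_n) => //= a s ->. Qed.

Lemma cabs_le_gmax (z : vec) : unit_ball z -> cabs (F z) <= gmax z.
Proof.
move=> zB; have := cabs_mderiv_le (fun=> 0%N) zB.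
rewrite /mfact /mpow !big1 ?mulr1//.
by rewrite mderiv0.
Qed.

(** Along a radial segment shorter than [eps / L] the weights [L] may be frozen
    at one end; the derivatives of order at most [m] then form a system whose
    derivatives, of order at most [m + 1], are controlled by the system itself
    because the index is bounded. *)
Lemma radial_step : exists eps C, [/\ 0 < eps, eps <= 1, 1 <= C &
  forall theta x j t, 0 <= x ord0 j -> 0 <= t -> rnorm x < 1 ->
    rnorm (upd x j t) < 1 -> `|t - x ord0 j| <= eps / L j (polar x theta) ->
    gmax (polar (upd x j t) theta) <= C * gmax (polar x theta)].
Proof.
have Lam1 := Lam_ge1; have Lam0 : 0 < Lam by lra.
have Lm1 : 1 <= Lam ^+ m by exact: exprn_ege1.
have Lm0 : 0 < Lam ^+ m by lra.
pose kap := m.+1%:R * Lam ^+ m.+1 * Lam ^+ m.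
have kap1 : 1 <= kap.
  rewrite -[leLHS]mulr1 -[X in X * _]mulr1.
  by rewrite /kap !ler_pM ?ler1n ?exprn_ege1.
have kap0 : 0 < kap by lra.
(* kap bounds the derivatives of the frozen system, eps is short enough for
   short_interval_growth *)
pose eps := (4 * kap)^-1.
have eps0 : 0 < eps by rewrite invr_gt0; lra.
have eps1 : eps <= 1 by rewrite invf_le1; lra.
exists eps, (2 * Lam ^+ m); split => //; first by lra.
move=> theta x j t x0 t0 xB tB tx.
pose s := t - x ord0 j; pose z := polar x theta.
have zB : unit_ball z by rewrite unit_ball_polar.
pose w u := polar (upd x j (x ord0 j + u * s)) theta.
have w1 : w 1 = polar (upd x j t) theta by rewrite /w mul1r /s addrC subrK.
have w0 : w 0 = z by rewrite /w mul0r addr0 upd_id.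
have rB u : u \in `[0, 1]%R -> rnorm (upd x j (x ord0 j + u * s)) < 1.
  by rewrite in_itv/=; exact: rnorm_segment.
have wB u : u \in `[0, 1]%R -> unit_ball (w u).
  by move=> /rB; rewrite unit_ball_polar.
have Lj0 : 0 < L j z by exact: L_gt0.
have near u : u \in `[0, 1]%R ->
    forall k, L k (w u) <= Lam * L k z /\ L k z <= Lam * L k (w u).
  move=> u01 k; apply: (L_comp.2) => // i; rewrite cabs_polarB updE.
  case: eqP => [->|_]; last by rewrite subrr normr0 divr_ge0// ltW// L_gt0.
  rewrite addrC addKr normrM; move: u01; rewrite in_itv/= => /andP[u0 u1].
  rewrite (ger0_norm u0); apply: le_trans (_ : `|s| <= _).
    by rewrite ler_piMl.
  by apply: le_trans tx _; rewrite ler_pM2r ?invr_gt0.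
have Lpow (u : R) (K : 'I_n -> nat) : u \in `[0, 1]%R -> (mdeg K <= m)%N ->
    mpow (fun k => L k (w u)) K <= Lam ^+ m * mpow (fun k => L k z) K /\
    mpow (fun k => L k z) K <= Lam ^+ m * mpow (fun k => L k (w u)) K.
  move=> u01 Km; have zw := near u u01; split; apply: mpow_le => // k.
  - by rewrite ltW// L_gt0//; exact: wB.
  - by case: (zw k).
  - by rewrite ltW// L_gt0.
  - by case: (zw k).
pose W (K : 'I_n -> nat) := (mfact K)%:R * mpow (fun k => L k z) K.
have W0 K : 0 < W K by exact: deriv_weight_gt0.
pose I := {ffun 'I_n -> 'I_m.+1}.
pose nt (K : I) : 'I_n -> nat := fun k => K k : nat.
pose P (K : I) := (mdeg (nt K) <= m)%N.
pose phi (K : I) u : Cplx R := ((W (nt K))^-1)%:C * mderiv (nt K) F (w u).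
pose phi' (K : I) u : Cplx R := ((W (nt K))^-1)%:C *
  (s%:C * direction theta j * mderiv (addone (nt K) j) F (w u)).
have cphi K u : cabs (phi K u) = cabs (mderiv (nt K) F (w u)) / W (nt K).
  by rewrite cabsM cabs_real normfV gtr0_norm// mulrC.
have gw u S : u \in `[0, 1]%R -> 0 <= S -> (forall K, P K -> cabs (phi K u) <= S) ->
    gmax (w u) <= Lam ^+ m * S.
  move=> u01 S0 H; apply: bigmax_le; first by rewrite mulr_ge0// ltW.
  move=> K PK; have := H K PK; rewrite cphi ler_pdivrMr// => H1.
  rewrite /norm_deriv ler_pdivrMr ?deriv_weight_gt0//; last exact: wB.
  have le2 := ler_wpM2l S0 (ler_wpM2l (ler0n R (mfact (nt K))) (Lpow u _ u01 PK).2).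
  apply: le_trans H1 (le_trans le2 _).
  by rewrite le_eqVlt; apply/orP; left; apply/eqP; ring.
have := @short_interval_growth R I P phi phi' 0 1 (eps * kap) (gmax z) ler01.
have epskap : 4 * (eps * kap) = 1.
  by rewrite mulrCA mulrC /eps divff// gt_eqF//; lra.
have ek0 : 0 <= eps * kap by apply: mulr_ge0; apply: ltW.
move=> /(_ ek0); rewrite epskap subr0 mulr1 => /(_ (lexx _)) H.
have {}H : forall K t0, P K -> t0 \in `[0, 1]%R -> cabs (phi K t0) <= 2 * gmax z.
  apply: H => [K u PK u01|K u S PK u01 HS| |K PK]; last 2 first.
  - exact: gmax_ge0.
  - by rewrite cphi w0; exact: index_m.
  - move=> e e0.
    have rc := @radial_cderiv R n (mderiv (nt K) F) x theta j (x ord0 j) s u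
      (analytic_mderiv (nt K) aF) (rB _ u01).
    rewrite (pderiv_mderiv (nt K) j aF (wB _ u01)) in rc.
    have eW : 0 < e * W (nt K) by rewrite mulr_gt0.
    have [d d0 Hd] := rc _ eW; exists d => // h hd.
    have -> : phi K (u + h) - phi K u - h%:C * phi' K u = ((W (nt K))^-1)%:C *
       (mderiv (nt K) F (w (u + h)) - mderiv (nt K) F (w u) - h%:C *
       (s%:C * direction theta j * mderiv (addone (nt K) j) F (w u))).
      by rewrite /phi /phi'; ring.
    rewrite cabsM cabs_real normfV (gtr0_norm (W0 _)) mulrC ler_pdivrMr//.
    by rewrite [leRHS]mulrAC; exact: Hd.
  have S0 : 0 <= S.
    by apply: le_trans (HS K PK); exact: cabs_ge0.
  have gS := gw u S u01 S0 HS.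
  rewrite /phi' !cabsM !cabs_real cabs_direction mulr1 normfV (gtr0_norm (W0 _)).
  rewrite mulrC ler_pdivrMr//.
  have b1 := cabs_mderiv_le (addone (nt K) j) (wB _ u01).
  rewrite mfact_addone mpow_addone natrM in b1.
  have [b2 _] := Lpow u _ u01 PK; have [b3 _] := near u u01 j.
  have Kj : (nt K j).+1%:R <= m.+1%:R :> R.
    by rewrite ler_nat ltnS (leq_trans (le_mdeg _ j)).
  have g0 := gmax_ge0 (w u).
  set MF : R := (mfact (nt K))%:R in b1 *.
  have MF0 : 0 <= MF by rewrite /MF.
  set pw := mpow (fun k => L k (w u)) (nt K) in b1 b2.
  set pz := mpow (fun k => L k z) (nt K) in b2 *.
  have pw0 : 0 <= pw.
    by apply: prodr_ge0 => k _; rewrite exprn_ge0// ltW// L_gt0//; exact: wB.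
  have Lw0 : 0 <= L j (w u) by rewrite ltW// L_gt0//; exact: wB.
  have pz0 : 0 <= pz by apply: prodr_ge0 => k _; rewrite exprn_ge0// ltW// L_gt0.
  have -> : eps * kap * S * W (nt K) = (eps / L j z) *
     ((Lam ^+ m * S) * ((m.+1%:R * MF) * ((Lam * L j z) * (Lam ^+ m * pz)))).
    rewrite /kap /W -/MF -/pz exprS.
    transitivity (eps * (m.+1%:R * (Lam * Lam ^+ m) * Lam ^+ m) * S * (MF * pz) *
       (L j z / L j z)); first by rewrite divff ?mulr1// gt_eqF.
    by move: (Lam ^+ m) (m.+1%:R) => *; ring.
  apply: ler_pM => //; first exact: cabs_ge0.
  apply: le_trans b1 _; apply: ler_pM => //.
    by rewrite !mulr_ge0.
  apply: ler_pM => //; rewrite ?mulr_ge0//.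
    by rewrite ler_wpM2r.
  exact: ler_pM.
have i01 : (1 : R) \in `[0, 1]%R by rewrite in_itv/= ler01 lexx.
have := gw 1 (2 * gmax z) i01; rewrite w1 mulrA (mulrC _ 2); apply.
  by rewrite mulr_ge0// gmax_ge0.
by move=> K PK; exact: H.
Qed.

End Growth.

(** * From steps to integrals *)

Section IntegralGrowth.
Variable R : realType.
Implicit Types (l g : R -> R) (a b t u : R).
Local Notation J l a b := (\int[lebesgue_measure]_(t in `[a, b]) l t).

Definition continuous_on_itv l a b := forall t, t \in `[a, b]%R -> {for t, continuous l}.

Lemma integrable_on_itv l a b : continuous_on_itv l a b ->
  lebesgue_measure.-integrable `[a, b] (EFin \o l).
Proof.
move=> cl; apply: continuous_compact_integrable; first exact: segment_compact.
by apply: continuous_in_subspaceT => t /[!inE]/= tab; exact: cl.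
Qed.

Lemma continuous_on_sub l a b a' b' : a <= a' -> b' <= b ->
  continuous_on_itv l a b -> continuous_on_itv l a' b'.
Proof.
move=> aa bb cl t; rewrite in_itv/= => /andP[at_ tb]; apply: cl.
by rewrite in_itv/=; apply/andP; split; lra.
Qed.

Lemma integral_split l a u b : a <= u -> u <= b -> continuous_on_itv l a b ->
  J l a b = J l a u + J l u b.
Proof.
move=> au ub cl.
have iab := integrable_on_itv cl.
have iub := integrable_on_itv (continuous_on_sub au (lexx b) cl).
have := @Rintegral_itvB R l (BLeft a) (BRight b) u iab.
rewrite !bnd_simp => /(_ au ub) E.
rewrite Rintegral_itv_obnd_cbnd in E; last first.
  apply: integrableS iub => //=.
  by move=> t /=; rewrite !in_itv/= => /andP[/ltW -> ->].
by rewrite -E addrC subrK.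
Qed.

Lemma integral_ge_cst l a b (k : R) : a <= b -> continuous_on_itv l a b ->
  (forall t, t \in `[a, b]%R -> k <= l t) -> k * (b - a) <= J l a b.
Proof.
move=> ab cl kl.
have -> : k * (b - a) = J (fun=> k) a b.
  rewrite Rintegral_cst//= lebesgue_measure_itv/= lte_fin.
  case: ltP => [_|ba]; first by rewrite -EFinD.
  by have -> : b = a; [lra|rewrite subrr !mulr0].
apply: le_Rintegral => //; last exact: integrable_on_itv.
by apply: integrable_on_itv => t _; exact: cvg_cst.
Qed.

(** A step of length [eps / l] multiplies [g] by at most [C], and contributes at
    least [eps / Lam] to the integral of [l]; so the number of steps from [a] to
    [b] is at most one more than [Lam / eps] times the integral. *)
Lemma integral_growth l g a b (eps Lam C : R) : a <= b ->
  0 < eps <= 1 -> 1 <= Lam -> 1 <= C ->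
  continuous_on_itv l a b -> (forall t, t \in `[a, b]%R -> 1 <= l t) ->
  (forall t t', a <= t -> t <= t' -> t' <= b -> t' - t <= 1 / l t ->
     l t <= Lam * l t') ->
  (forall t, 0 <= g t) ->
  (forall t t', a <= t -> t <= t' -> t' <= b -> t' - t <= eps / l t ->
     g t' <= C * g t) ->
  g b <= C * expR (ln C * Lam / eps * J l a b) * g a.
Proof.
move=> ab /andP[eps0 eps1] Lam1 C1 cl l1 lLam g0 gC.
set A := ln C * Lam / eps.
have lnC : 0 <= ln C by rewrite ln_ge0.
have A0 : 0 <= A by rewrite divr_ge0 ?mulr_ge0 ?(ltW eps0)//; lra.
have exp1 (x : R) : 0 <= x -> 1 <= expR x
  by move=> x0; rewrite -[leLHS](@expR0 R) ler_expR.
have [B lB] : exists B, forall t, t \in `[a, b]%R -> l t <= B.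
  have cw : {within `[a, b], continuous l}.
    by apply: continuous_in_subspaceT => t /[!inE]/= tab; exact: cl.
  by have [t _ H] := EVT_max ab cw; exists (l t).
have iab u : a <= u <= b -> u \in `[a, b]%R by rewrite in_itv.
have B1 : 1 <= B by apply: le_trans (l1 a _) (lB a _); apply: iab; rewrite lexx.
have B0 : 0 < B by lra.
(* every step has length at least d, hence finitely many reach b *)
pose d := eps / B; have d0 : 0 < d by rewrite divr_gt0.
have main (N : nat) u : a <= u -> u <= b -> b - u <= N%:R * d ->
    g b <= C * expR (A * J l u b) * g u.
  elim: N u => [|N IH] u au ub.
    rewrite mul0r => bu; have -> : u = b by lra.
    rewrite -[leLHS]mul1r ler_wpM2r// mulr_ege1//; apply: exp1; apply: mulr_ge0 => //.
    have := @integral_ge_cst l b b 0 (lexx b); rewrite mul0r; apply.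
      exact: continuous_on_sub cl.
    move=> t; rewrite in_itv/= => tb; have /l1 : t \in `[a, b]%R.
      by apply: iab; lra.
    by lra.
  move=> bu.
  have lu1 : 1 <= l u by apply: l1; apply: iab; lra.
  have lu0 : 0 < l u by lra.
  have cu : continuous_on_itv l u b by apply: continuous_on_sub cl.
  have [near|far] := leP (b - u) (eps / l u).
    have gb : g b <= C * g u by apply: gC.
    apply: le_trans gb _; rewrite ler_wpM2r// ler_peMr//; first by lra.
    apply: exp1; apply: mulr_ge0 => //.
    apply: le_trans (integral_ge_cst ub cu (k := 0) _); first by rewrite mul0r.
    move=> t; rewrite in_itv/= => tb; have /l1 : t \in `[a, b]%R by apply: iab; lra.
    by lra.
  pose v := u + eps / l u.
  have uv : u <= v by rewrite lerDl divr_ge0 ?ltW.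
  have vb : v <= b by rewrite /v; lra.
  have vu : v - u = eps / l u by rewrite /v addrC addKr.
  have gv : g v <= C * g u by apply: gC => //; rewrite vu.
  have dl : d <= eps / l u.
    rewrite /d ler_pM2l// lef_pV2 ?posrE//; apply: lB; apply: iab; lra.
  have gb : g b <= C * expR (A * J l v b) * g v.
    apply: IH => //; first by lra.
    by rewrite -natr1 mulrDl mul1r in bu; lra.
  have Juv : eps / Lam <= J l u v.
    apply: le_trans (integral_ge_cst uv (continuous_on_sub (lexx u) vb cu)
      (k := l u / Lam) _).
      by rewrite vu le_eqVlt; apply/orP; left; apply/eqP; field; rewrite !gt_eqF//; lra.
    move=> t; rewrite in_itv/= => /andP[ut tv]; rewrite ler_pdivrMr; last by lra.
    rewrite mulrC; apply: lLam => //; first exact: le_trans tv vb.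
    apply: (@le_trans _ _ (v - u)); first by rewrite lerB.
    by rewrite vu ler_pM2r ?invr_gt0.
  have Ce : C <= expR (A * J l u v).
    rewrite -[C in leLHS]lnK ?posrE; last by lra.
    rewrite ler_expR; apply: le_trans (ler_wpM2l A0 Juv).
    rewrite /A le_eqVlt; apply/orP; left; apply/eqP; field.
    by rewrite !gt_eqF//; lra.
  rewrite (integral_split uv vb cu) mulrDr expRD.
  apply: le_trans gb _.
  have CE0 : 0 <= C * expR (A * J l v b) by rewrite mulr_ge0 ?expR_ge0//; lra.
  apply: le_trans (ler_wpM2l CE0 (le_trans gv (ler_wpM2r (g0 u) Ce))) _.
  by rewrite le_eqVlt; apply/orP; left; apply/eqP; ring.
have [N HN] : exists N : nat, b - a <= N%:R * d.
  exists (Num.truncn ((b - a) / d)).+1; rewrite -ler_pdivrMr// ltW//.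
  exact: truncnS_gt.
exact: (main N a).
Qed.

End IntegralGrowth.

(** * The maximum principle on polydiscs *)

Section MaximumPrinciple.
Variables (R : realType) (n : nat).
Local Notation vec := 'rV[Cplx R]_n.
Local Notation e_ j := (delta_mx ord0 j : vec).
Implicit Types (F : vec -> Cplx R) (z : vec) (j k : 'I_n).

Definition circle (s t : R) : Cplx R := (s * cos t) +i* (s * sin t).

Lemma cabs_circle s t : cabs (circle s t) = `|s|.
Proof.
by rewrite /cabs/= !exprMn -mulrDr cos2Dsin2 mulr1 sqrtr_sqr.
Qed.

Lemma polar_form (w : Cplx R) :
  exists2 t, 0 <= t <= 2 * pi & w = circle (cabs w) t.
Proof.
have pi0 : 0 <= pi :> R by exact: pi_ge0.
have [->|w0] := eqVneq w 0.
  exists 0; first by rewrite lexx mulr_ge0.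
  by rewrite cabs0 /circle !mul0r.
have r0 : 0 < cabs w by rewrite cabs_gt0.
case: w w0 r0 => a b w0; set r := cabs _ => r0.
have r2 : a ^+ 2 + b ^+ 2 = r ^+ 2.
  by rewrite /r /cabs/= sqr_sqrtr// addr_ge0 ?sqr_ge0.
pose x := a / r.
have xx : x ^+ 2 + (b / r) ^+ 2 = 1.
  by rewrite /x !exprMn -mulrDl r2 -exprMn divff ?expr1n// gt_eqF.
have x1 : -1 <= x <= 1.
  by have := sqr_ge0 (b / r); move=> ?; apply/andP; split; nra.
have [/andP[t0 tpi] ct] := acos_def x1.
have st : sin (acos x) = `|b / r|.
  rewrite sin_acos// -sqrtr_sqr; congr Num.sqrt; lra.
have ra : r * x = a by rewrite /x mulrCA divff ?mulr1// gt_eqF.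
have rb : r * (b / r) = b by rewrite mulrCA divff ?mulr1// gt_eqF.
have [b0|b0] := leP 0 (b / r).
  exists (acos x); first by rewrite t0/=; lra.
  by rewrite /circle ct st ger0_norm// ra rb.
exists (pi *+ 2 - acos x); first by rewrite mulr2n; apply/andP; split; lra.
rewrite /circle cosB sinB cos2pi sin2pi ct st ltr0_norm//.
by rewrite mul1r !mul0r addr0 sub0r mul1r opprK ra rb.
Qed.

Lemma torus_polar (r : 'rV[R]_n) z : torus r z ->
  exists2 theta, angles theta & z = polar r theta.
Proof.
move=> zr; have /choice[t Ht] : forall k, exists t, 0 <= t <= 2 * pi /\
    z ord0 k = circle (cabs (z ord0 k)) t.
  by move=> k; have [t ? ?] := polar_form (z ord0 k); exists t.
exists (\row_k t k); first by move=> k; rewrite mxE; case: (Ht k).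
apply/rowP => k; rewrite !mxE.
by case: (Ht k) => _ {1}->; rewrite /circle zr.
Qed.

Lemma polar_torus (r theta : 'rV[R]_n) : nonneg_vec r -> torus r (polar r theta).
Proof. by move=> r0 k; rewrite cabs_polar ger0_norm. Qed.

Lemma circle_continuous (p : R * R) e : 0 < e ->
  \forall q \near p, cabs (circle p.1 p.2 - circle q.1 q.2) < e.
Proof.
move=> e0.
have c1 : (fun q : R * R => q.1 * cos q.2) @ p --> p.1 * cos p.2.
  by apply: cvgM; [exact: cvg_fst|apply: cvg_comp; [exact: cvg_snd|exact: continuous_cos]].
have c2 : (fun q : R * R => q.1 * sin q.2) @ p --> p.1 * sin p.2.
  by apply: cvgM; [exact: cvg_fst|apply: cvg_comp; [exact: cvg_snd|exact: continuous_sin]].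
have e2 : 0 < e / 2 by rewrite divr_gt0.
move/cvgrPdist_lt/(_ _ e2) in c1; move/cvgrPdist_lt/(_ _ e2) in c2.
apply: filterS2 c1 c2 => q H1 H2.
apply: le_lt_trans (cabs_le_ReIm _) _; rewrite /circle/=; lra.
Qed.

Lemma analytic_continuous_along F z j e : analytic_on_ball F -> unit_ball z ->
  0 < e -> exists2 d, 0 < d & forall h, cabs h < d ->
    cabs (F (z + h *: e_ j) - F z) <= e.
Proof.
move=> aF zB e0; have [C [d [C0 d0 H]]] := analytic_second_order j aF zB.
pose A := cabs (pderiv j F z) + C + 1.
have A0 : 0 < A by rewrite ltr_wpDl// addr_ge0// cabs_ge0.
exists (Num.min 1 (Num.min d (e / A))); first by rewrite !lt_min ltr01 d0 divr_gt0.
move=> h; rewrite !lt_min ltr_pdivlMr// => /and3P[h1 hd hA].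
have -> : F (z + h *: e_ j) - F z =
  (F (z + h *: e_ j) - F z - h * pderiv j F z) + h * pderiv j F z by ring.
apply: le_trans (cabsD _ _) _; rewrite cabsM.
have := H h hd; have := cabs_ge0 h; have := cabs_ge0 (pderiv j F z).
have : C * cabs h ^+ 2 <= C * cabs h.
  by rewrite ler_wpM2l// expr2 ler_piMr ?cabs_ge0// ltW.
rewrite /A in hA; lra.
Qed.

(** Averaging over the four points [z + i^k h] kills the Taylor terms of orders
    one and two, as the sums of [i^k] and of [i^(2k)] vanish. *)
Lemma four_point_mean F z j : analytic_on_ball F -> unit_ball z ->
  exists C delta, [/\ 0 <= C, 0 < delta & forall h : R, 0 <= h < delta ->
    4 * cabs (F z) <= cabs (F (z + h%:C *: e_ j)) + cabs (F (z + (- h%:C) *: e_ j))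
     + cabs (F (z + ('i%C * h%:C) *: e_ j)) + cabs (F (z + (- ('i%C * h%:C)) *: e_ j))
     + C * h ^+ 3].
Proof.
move=> aF zB; have [a [rho Fz]] := analytic_expansion aF zB.
have [C [d [C0 d0 H]]] := center_taylor j 3 Fz.
pose T h : Cplx R := F (z + h *: e_ j) - (a (axis j 0) + a (axis j 1) * h + a (axis j 2) * h ^+ 2).
have HT h : cabs h < d -> cabs (T h) <= C * cabs h ^+ 3.
  move=> /H; rewrite !big_ord_recl big_ord0/= /T expr0 mulr1 expr1 addr0 !addrA.
  by [].
have F0 : F z = a (axis j 0).
  have := HT 0; rewrite cabs0 => /(_ d0); rewrite /T scale0r addr0 mulr0.
  rewrite !expr0n/= !mulr0 !addr0 => H0; apply/eqP; rewrite -subr_eq0; apply/eqP.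
  by apply: cabs_eq0; apply/eqP; rewrite eq_le H0 cabs_ge0.
exists (4 * C), d; split=> //; first by rewrite mulr_ge0.
move=> h /andP[h0 hd].
have ci : cabs ('i%C : Cplx R) = 1.
  by rewrite /cabs/= expr0n/= add0r expr1n sqrtr1.
have i2 : ('i%C : Cplx R) ^+ 2 = -1 by exact: sqr_i.
set h1 : Cplx R := h%:C; set ih : Cplx R := 'i%C * h1.
have ch : cabs h1 = h by rewrite cabs_real ger0_norm.
have cih : cabs ih = h by rewrite cabsM ci mul1r.
have ihE : ih ^+ 2 = - h1 ^+ 2 by rewrite exprMn i2 mulN1r.
clearbody ih; clearbody h1.
have cancel (x1 x2 x3 x4 a0 a1 a2 : Cplx R) : 4 * a0 = x1 + x2 + x3 + x4 -
   ((x1 - (a0 + a1 * h1 + a2 * h1 ^+ 2)) + (x2 - (a0 + a1 * - h1 + a2 * (- h1) ^+ 2))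
   + (x3 - (a0 + a1 * ih + a2 * ih ^+ 2)) + (x4 - (a0 + a1 * - ih + a2 * (- ih) ^+ 2))).
  by rewrite !sqrrN ihE; ring.
have E : (4 : Cplx R) * F z = F (z + h1 *: e_ j) + F (z + (- h1) *: e_ j)
    + F (z + ih *: e_ j) + F (z + (- ih) *: e_ j)
    - (T h1 + T (- h1) + T ih + T (- ih)).
  by rewrite F0; exact: cancel.
have -> : 4 * cabs (F z) = cabs ((4 : Cplx R) * F z) by rewrite cabsM cabs_nat.
have T1 := HT h1; have T2 := HT (- h1); have T3 := HT ih; have T4 := HT (- ih).
rewrite ?cabsN ?cih ?ch in T1 T2 T3 T4.
have tri (x1 x2 x3 x4 : Cplx R) :
    cabs (x1 + x2 + x3 + x4) <= cabs x1 + cabs x2 + cabs x3 + cabs x4.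
  by do 3![apply: le_trans (cabsD _ _) _; rewrite lerD2r].
rewrite E; apply: le_trans (cabsB _ _) _.
apply: le_trans (lerD (tri _ _ _ _) (tri _ _ _ _)) _; rewrite lerD2l.
apply: le_trans (lerD (lerD (lerD (T1 hd) (T2 hd)) (T3 hd)) (T4 hd)) _.
clear; lra.
Qed.

(** An interior maximum of [|F| + eps |w|^2] would contradict
    [four_point_mean], the quadratic term winning against the cubic error. *)
Lemma maximum_principle_disc F z j rho M : analytic_on_ball F -> 0 <= rho ->
  (forall w, cabs w <= rho -> unit_ball (upd z j w)) ->
  (forall w, cabs w = rho -> cabs (F (upd z j w)) <= M) ->
  forall w, cabs w <= rho -> cabs (F (upd z j w)) <= M.
Proof.
move=> aF rho0 discB circM w0 w0rho.
have upd_shift (w h : Cplx R) : upd z j (w + h) = upd z j w + h *: e_ j.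
  apply/rowP => k; rewrite shiftE !updE; case: eqP => // _; by rewrite addr0.
apply/ler_addgt0Pr => e1 e10.
pose eps := e1 / (rho ^+ 2 + 1).
have D0 : 0 < rho ^+ 2 + 1 by rewrite ltr_wpDl// sqr_ge0.
have eps0 : 0 < eps by rewrite divr_gt0.
pose f w := cabs (F (upd z j w)).
pose D : set (R * R) := `[0, rho] `*` `[0, 2 * pi].
pose u (p : R * R) := f (circle p.1 p.2) + eps * p.1 ^+ 2.
have cD : compact D by apply: compact_setX; exact: segment_compact.
have Dn0 : D !=set0.
  exists (0, 0); split; rewrite /= in_itv/= lexx//= mulr_ge0//; exact: pi_ge0.
have cu : {within D, continuous u}.
  apply: continuous_in_subspaceT => p /[!inE] -[/= p1 _].
  move: p1; rewrite in_itv/= => /andP[p10 p1r].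
  have pB : unit_ball (upd z j (circle p.1 p.2)).
    by apply: discB; rewrite cabs_circle ger0_norm.
  apply: cvgD; last first.
    apply: cvgM; first exact: cvg_cst.
    have -> : (fun q : R * R => q.1 ^+ 2) = (fun q : R * R => q.1 * q.1).
      by apply: funext => q; rewrite expr2.
    rewrite expr2; apply: cvgM; exact: cvg_fst.
  apply/cvgrPdist_le => e e0.
  have [d d0 Hd] := analytic_continuous_along j aF pB e0.
  apply: filterS (circle_continuous p d0) => q Hq.
  rewrite /f.
  have := Hd (circle q.1 q.2 - circle p.1 p.2); rewrite cabsBC => /(_ Hq).
  rewrite -upd_shift [circle p.1 p.2 + _]addrC subrK => H.
  set x := F _ in H *; set y := F _ in H *.
  clearbody x y.
  rewrite ler_norml; apply/andP; split.
    have := cabsD (x - y) y; rewrite subrK; lra.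
  have := cabsD (y - x) x; rewrite subrK cabsBC; lra.
have [p /[!inE] -[/= p1 p2] Hmax] := compact_EVT_max Dn0 cD cu.
have wmax w : cabs w <= rho -> f w + eps * cabs w ^+ 2 <= u p.
  move=> wr; have [t t2 wE] := polar_form w.
  have := Hmax (cabs w, t); rewrite inE /u/= -wE; apply.
  by split; rewrite /= in_itv//= cabs_ge0.
move: p1; rewrite in_itv/= => /andP[p10 p1r].
set w := circle p.1 p.2 in u cu Hmax wmax *.
have cw : cabs w = p.1 by rewrite cabs_circle ger0_norm.
have fin : f w0 <= M + e1.
  have := wmax _ w0rho; rewrite /u -/w.
  have [E|pr] := eqVneq p.1 rho.
    have := circM w; rewrite cw => /(_ E); rewrite -/(f w) E => fwM.
    have : eps * (rho ^+ 2 + 1) = e1 by rewrite /eps divfK// gt_eqF.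
    have : 0 <= eps * cabs w0 ^+ 2 by rewrite mulr_ge0 ?exprn_ge0 ?cabs_ge0// ltW.
    by clear -fwM eps0; lra.
  have plt : p.1 < rho by rewrite lt_neqAle pr.
  have wB : unit_ball (upd z j w) by apply: discB; rewrite cw.
  have [C [d [C0 d0 Hm]]] := four_point_mean j aF wB.
  exfalso.
  pose h := Num.min (d / 2) (Num.min (rho - p.1) (eps / (C + 1))).
  have h0 : 0 < h by rewrite !lt_min !divr_gt0 ?subr_gt0//; lra.
  have [hd hr hC] : [/\ h < d, p.1 + h <= rho & h * (C + 1) <= eps].
    have C1 : 0 < C + 1 by lra.
    have : h <= h by []; rewrite {2}/h !le_min -(ler_pdivlMr _ _ C1).
    by move=> /and3P[? ? ?]; split => //; lra.
  have := Hm h; rewrite (ltW h0) hd => /(_ isT).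
  rewrite -!upd_shift -!/(f _).
  have ch : cabs (h%:C : Cplx R) = h by rewrite cabs_real gtr0_norm.
  have ci : cabs ('i%C * h%:C : Cplx R) = h.
    by rewrite cabsM ch /cabs/= expr0n/= add0r expr1n sqrtr1 mul1r.
  have pt (v : Cplx R) : cabs v = h ->
      f (w + v) + eps * cabs (w + v) ^+ 2 <= f w + eps * p.1 ^+ 2.
    move=> vh; apply: wmax; apply: le_trans (cabsD _ _) _; rewrite cw vh//.
  have := pt _ ch; have := pt (- h%:C); rewrite cabsN => /(_ ch).
  have := pt _ ci; have := pt (- ('i%C * h%:C)); rewrite cabsN => /(_ ci).
  have par : cabs (w + h%:C) ^+ 2 + cabs (w + - h%:C) ^+ 2 + cabs (w + 'i%C * h%:C) ^+ 2
     + cabs (w + - ('i%C * h%:C)) ^+ 2 = 4 * p.1 ^+ 2 + 4 * h ^+ 2.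
    rewrite -cw; case: (w) => a b; rewrite /cabs/=.
    by rewrite !sqr_sqrtr ?addr_ge0 ?sqr_ge0//; ring.
  move: par (f _) (f _) (f _) (f _) (f _).
  move: (cabs _ ^+ 2) (cabs _ ^+ 2) (cabs _ ^+ 2) (cabs _ ^+ 2).
  move=> q1 q2 q3 q4 par f0 f1 f2 f3 f4.
  move=> A1 A2 A3 A4 A5.
  have B : eps * (q4 + q3 + q2 + q1) = eps * (4 * p.1 ^+ 2 + 4 * h ^+ 2) by rewrite par.
  have quad : 4 * (eps * h ^+ 2) <= C * h ^+ 3 by clear -A1 A2 A3 A4 A5 B; lra.
  have cub : C * h ^+ 3 <= eps * h ^+ 2.
    by rewrite exprS mulrA ler_wpM2r ?sqr_ge0// (le_trans _ hC)//; clear -h0; lra.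
  have : 0 < eps * h ^+ 2 by rewrite mulr_gt0// exprn_gt0.
  by clear -quad cub; lra.
exact: fin.
Qed.

Lemma unit_ball_le (r : 'rV[R]_n) z : rnorm r < 1 ->
  (forall k, cabs (z ord0 k) <= r ord0 k) -> unit_ball z.
Proof.
move=> rB zr; rewrite /unit_ball/=; apply: le_lt_trans rB.
apply: ler_wsqrtr; apply: ler_sum => k _.
by rewrite lerXn2r ?nnegrE ?cabs_ge0// (le_trans (cabs_ge0 _) (zr k)).
Qed.

(** Push the coordinates onto their circles one at a time. *)
Lemma maximum_principle F (r : 'rV[R]_n) M : analytic_on_ball F -> rnorm r < 1 ->
  nonneg_vec r -> (forall z, torus r z -> cabs (F z) <= M) ->
  forall z, (forall k, cabs (z ord0 k) <= r ord0 k) -> cabs (F z) <= M.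
Proof.
move=> aF rB r0 HM.
suff H (i : nat) z : (forall k, cabs (z ord0 k) <= r ord0 k) ->
    (forall k : 'I_n, (i <= k)%N -> cabs (z ord0 k) = r ord0 k) -> cabs (F z) <= M.
  by move=> z zr; apply: (H n) => // k; rewrite leqNgt ltn_ord.
elim: i z => [|i IH] z zr zi; first by apply: HM => k; exact: zi.
have [ni|ni] := leqP n i.
  by apply: IH => // k ik; have := leq_trans ni ik; rewrite leqNgt ltn_ord.
pose j := Ordinal ni.
rewrite -(upd_id z j).
have le_upd (w : Cplx R) : cabs w <= r ord0 j ->
    forall k, cabs (upd z j w ord0 k) <= r ord0 k.
  by move=> wr k; rewrite updE; case: eqP => [->|].
apply: (@maximum_principle_disc F z j (r ord0 j) M aF (r0 j)); last exact: zr.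
  by move=> w /le_upd; exact: unit_ball_le.
move=> w wr; apply: IH; first by apply: le_upd; rewrite wr.
move=> k ik; rewrite updE; case: eqP => [->//|kj]; apply: zi.
rewrite ltn_neqAle ik andbT; apply/eqP => ik'; apply: kj.
by apply: val_inj; rewrite /= -ik'.
Qed.

End MaximumPrinciple.

(** * Radial paths and the maximum modulus *)

Section SecondOrder.
Variable R : realType.
Implicit Types f : R -> Cplx R.

(** Landau's inequality: a derivative is controlled by the size of the function
    and of the second derivative on a one-sided neighbourhood. *)
Lemma landau_inequality f f' f'' (B : R) :
  (forall u, u \in `[0, 1]%R -> cderiv f u (f' u)) ->
  (forall u, u \in `[0, 1]%R -> cderiv f' u (f'' u)) ->
  (forall u, u \in `[0, 1]%R -> cabs (f'' u) <= B) ->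
  cabs (f' 0) <= cabs (f 1) + cabs (f 0) + 4 * B.
Proof.
move=> df df' f''B.
have i0 : (0 : R) \in `[0, 1]%R by rewrite in_itv/= lexx ler01.
have B0 : 0 <= B by apply: le_trans (f''B 0 i0); exact: cabs_ge0.
have d1 u : u \in `[0, 1]%R -> cabs (f' u - f' 0) <= 2 * B.
  move=> /[dup] u01; rewrite in_itv/= => /andP[u0 u1].
  have sub v : v \in `[0, u]%R -> v \in `[0, 1]%R.
    by rewrite !in_itv/= => /andP[-> /le_trans]; apply.
  have := cderiv_mean_value u0 (fun v vu => df' v (sub v vu)) (fun v vu => f''B v (sub v vu)).
  by rewrite subr0 => /le_trans; apply; rewrite ler_piMr// mulr_ge0.
pose h (u : R) : Cplx R := f u - u%:C * f' 0.
have dh u : u \in `[0, 1]%R -> cderiv h u (f' u - f' 0).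
  move=> u01 e e0; have [d d0 H] := df u u01 e e0; exists d => // v vd.
  have -> : h (u + v) - h u - v%:C * (f' u - f' 0) = f (u + v) - f u - v%:C * f' u.
    rewrite /h rmorphD/=; move: (f _) (f _) (f' _) (f' _) => *.
    by move: (real_complex _ _) (real_complex _ _) => *; ring.
  exact: H.
have := cderiv_mean_value ler01 dh d1; rewrite subr0 mulr1 => H.
have hE : f' 0 = f 1 - f 0 - (h 1 - h 0).
  rewrite /h (rmorph1 (real_complex R)) (rmorph0 (real_complex R)).
  by move: (f 1) (f 0) (f' 0) => *; ring.
rewrite hE; apply: le_trans (cabsB _ _) _; apply: lerD; first exact: cabsB.
by apply: le_trans H _; clear; lra.
Qed.

End SecondOrder.

Section Paths.
Variables (R : realType) (n : nat) (L : 'I_n -> 'rV[Cplx R]_n -> R).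
Variables (F : 'rV[Cplx R]_n -> Cplx R) (Lam c : R) (m : nat).
Local Notation vec := 'rV[Cplx R]_n.
Local Notation gm := (gmax L F m).
Implicit Types (x y theta phi r : 'rV[R]_n) (j k : 'I_n).

Hypothesis aF : analytic_on_ball F.
Hypothesis L_ge1 : forall j (z : vec), unit_ball z -> 1 <= L j z.
Hypothesis L_comp : locally_comparable L Lam.
Hypothesis index_m : forall z : vec, unit_ball z -> forall J : 'I_n -> nat,
  norm_deriv L F z J <= gm z.
Hypothesis L_cont : forall j (z : vec), unit_ball z -> {for z, continuous (L j)}.
Hypothesis c_ge1 : 1 <= c.
Hypothesis L_torus : forall r theta1 theta2 j, nonneg_vec r -> rnorm r < 1 ->
  angles theta1 -> angles theta2 ->
  L j (polar r theta2) <= c * L j (polar r theta1).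

Lemma polar_upd_continuous x j theta :
  continuous (fun t : R => polar (upd x j t) theta : vec).
Proof.
move=> t.
have -> : (fun u : R => polar (upd x j u) theta) = (fun u : R =>
    polar (upd x j 0) theta + (u%:C * direction theta j) *: (delta_mx ord0 j : vec)).
  by apply: funext => u; rewrite -polar_upd add0r.
apply: cvgD; first exact: cvg_cst.
apply: cvgZ; last exact: cvg_cst.
apply/cvg_cabsP => e e0; near=> u.
rewrite -mulrBl cabsM cabs_direction mulr1 -rmorphB cabs_real.
near: u; exact: cvgr_dist_lt.
Unshelve. all: by end_near. Qed.

Lemma L_path_continuous x j k theta t : rnorm (upd x j t) < 1 ->
  {for t, continuous (fun u => L k (polar (upd x j u) theta))}.
Proof.
rewrite -(unit_ball_polar _ theta) => tB.
by apply: continuous_comp; [exact: polar_upd_continuous|exact: L_cont].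
Qed.

Lemma nonneg_upd x j t : nonneg_vec x -> 0 <= t -> nonneg_vec (upd x j t).
Proof. by move=> x0 t0 k; rewrite updE; case: eqP. Qed.

(** The integral may be taken at angles [theta] other than those of the points
    compared: shortening the steps by the factor [c] of [L_torus] makes them
    admissible at both. *)
Lemma path_growth : exists A C, [/\ 0 <= A, 1 <= C &
  forall x j b theta phi, nonneg_vec x -> x ord0 j <= b ->
    rnorm (upd x j b) < 1 -> angles theta -> angles phi ->
    gm (polar (upd x j b) phi) <= C *
      expR (A * \int[lebesgue_measure]_(t in `[x ord0 j, b])
                  L j (polar (upd x j t) theta)) * gm (polar x phi)].
Proof.
have [eps [C [eps0 eps1 C1 step]]] := radial_step aF L_ge1 L_comp index_m.
have c0 : 0 < c := lt_le_trans ltr01 c_ge1.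
have Lam1 := Lam_ge1 L_comp.
pose eps' := eps / c.
have eps'0 : 0 < eps' by rewrite divr_gt0.
have eps'1 : eps' <= 1 by rewrite ler_pdivrMr// mul1r (le_trans eps1).
exists (ln C * Lam / eps'), C; split => //.
  by rewrite divr_ge0 ?(ltW eps'0)// mulr_ge0 ?ln_ge0//; lra.
move=> x j b theta phi x0 xb bB th ph.
pose l t := L j (polar (upd x j t) theta).
pose g t := gm (polar (upd x j t) phi).
have tB t : x ord0 j <= t -> t <= b -> rnorm (upd x j t) < 1.
  by move=> xt tb; apply: (@rnorm_upd_lt1 R n x j (x ord0 j) b t) => //; rewrite xt.
have uB t (al : 'rV[R]_n) : x ord0 j <= t -> t <= b -> unit_ball (polar (upd x j t) al).
  by move=> xt tb; rewrite unit_ball_polar; exact: tB.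
have tx0 t : x ord0 j <= t -> nonneg_vec (upd x j t).
  by move=> xt; apply: nonneg_upd => //; exact: le_trans (x0 j) xt.
have ends : g (x ord0 j) = gm (polar x phi) by rewrite /g upd_id.
rewrite -ends -/(g b).
apply: (@integral_growth R l g (x ord0 j) b eps' Lam C) => //.
- by rewrite eps'0.
- by move=> t; rewrite in_itv/= => /andP[xt tb]; apply: L_path_continuous; exact: tB.
- by move=> t; rewrite in_itv/= => /andP[xt tb]; apply: L_ge1; exact: uB.
- move=> t t' xt tt' t'b le.
  have tb := le_trans tt' t'b.
  suff H : forall k,
      cabs (polar (upd x j t') theta ord0 k - polar (upd x j t) theta ord0 k)
      <= 1 / L k (polar (upd x j t) theta).
    by case: (L_comp.2 _ _ j (uB t theta xt tb) H).
  move=> k; rewrite cabs_polarB !updE; case: eqP => [->|_].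
    by rewrite ger0_norm// subr_ge0.
  by rewrite subrr normr0 divr_ge0// (le_trans ler01)// L_ge1//; exact: uB.
- by move=> t; exact: gmax_ge0.
move=> t t' xt tt' t'b le; have tb := le_trans tt' t'b.
rewrite /g -(upd_upd x j t t'); apply: step.
- exact: tx0.
- by apply: le_trans tt'; apply: le_trans (x0 j) xt.
- exact: tB.
- by rewrite upd_upd; apply: tB => //; exact: le_trans tt'.
rewrite updE eqxx ger0_norm ?subr_ge0//; apply: le_trans le _.
rewrite /eps' -mulrA ler_pM2l// -invfM lef_pV2 ?posrE.
- exact: L_torus (tx0 _ xt) (tB _ xt tb) th ph.
- by rewrite mulr_gt0// (lt_le_trans ltr01)// L_ge1//; exact: uB.
- by rewrite (lt_le_trans ltr01)// L_ge1//; exact: uB.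
Qed.

Lemma angles0 : angles (0 : 'rV[R]_n).
Proof. by move=> k; rewrite mxE lexx/= mulr_ge0// pi_ge0. Qed.

(** Radial paths from the centre bound [F] on a whole torus, the comparison of
    [L] along tori making the bound independent of the angles. *)
Lemma torus_bounded r : nonneg_vec r -> rnorm r < 1 ->
  exists B, forall z, torus r z -> cabs (F z) <= B.
Proof.
move=> r0 rB; have [A [C [A0 C1 path]]] := path_growth.
pose y (i : nat) : 'rV[R]_n := \row_k (if (k < i)%N then r ord0 k else 0).
have y0 i : nonneg_vec (y i) by move=> k; rewrite mxE; case: ifP.
have yB i : rnorm (y i) < 1.
  apply: le_lt_trans rB; apply: rnorm_le => k; rewrite mxE.
  by case: ifP => // _; rewrite normr0.
have bnd (i : nat) : (i <= n)%N ->
    exists B, forall phi, angles phi -> gm (polar (y i) phi) <= B.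
  elim: i => [_|i IH ni].
    exists (gm (polar (y 0%N) 0)) => phi _.
    have -> // : polar (y 0%N) phi = polar (y 0%N) 0.
    by apply/rowP => k; rewrite !polarE mxE/= (rmorph0 (real_complex R)) !mul0r.
  have [B HB] := IH (ltnW ni).
  pose j := Ordinal ni.
  have yS : y i.+1 = upd (y i) j (r ord0 j).
    apply/rowP => k; rewrite !mxE ltnS leq_eqVlt.
    have [->|kj] := eqVneq k j; first by rewrite /= eqxx.
    by rewrite -(inj_eq val_inj) /= in kj; rewrite (negbTE kj).
  have yj : y i ord0 j = 0 by rewrite mxE /= ltnn.
  exists (C * expR (A * \int[lebesgue_measure]_(t in `[y i ord0 j, r ord0 j])
                  L j (polar (upd (y i) j t) 0)) * B) => phi ph.
  rewrite yS; apply: le_trans (path (y i) j (r ord0 j) 0 phi _ _ _ angles0 ph) _ => //.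
  - by rewrite yj.
  - by rewrite -yS.
  - apply: ler_wpM2l; last exact: HB.
    by rewrite mulr_ge0 ?expR_ge0//; lra.
have [B HB] := bnd n (leqnn n).
have yn : y n = r by apply/rowP => k; rewrite mxE ltn_ord.
rewrite yn in HB.
exists B => z zr; have [phi ph ->] := torus_polar zr.
apply: le_trans (HB _ ph); apply: (cabs_le_gmax L_ge1 index_m).
by rewrite unit_ball_polar.
Qed.

Local Notation M := (max_modulus F).

Lemma le_max_modulus r z : nonneg_vec r -> rnorm r < 1 -> torus r z ->
  cabs (F z) <= M r.
Proof.
move=> r0 rB zr; have [B HB] := torus_bounded r0 rB.
apply: sup_upper_bound; last by exists z.
split; first by exists (cabs (F z)), z.
by exists B => _ [w wr <-]; exact: HB.
Qed.

Lemma max_modulus_le r (B : R) : nonneg_vec r ->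
  (forall z, torus r z -> cabs (F z) <= B) -> M r <= B.
Proof.
move=> r0 HB; apply: ge_sup.
  by exists (cabs (F (polar r 0))), (polar r 0) => //; exact: polar_torus.
by move=> _ [z zr <-]; exact: HB.
Qed.

Lemma le_max_modulus_polydisc r (z : vec) : nonneg_vec r -> rnorm r < 1 ->
  (forall k, cabs (z ord0 k) <= r ord0 k) -> cabs (F z) <= M r.
Proof.
move=> r0 rB; apply: (maximum_principle aF rB r0) => w wr; exact: le_max_modulus.
Qed.

Lemma max_modulus_ge0 r : nonneg_vec r -> rnorm r < 1 -> 0 <= M r.
Proof.
move=> r0 rB; apply: le_trans (cabs_ge0 (F (polar r 0))) _.
by apply: le_max_modulus => //; exact: polar_torus.
Qed.

Lemma max_modulus_mono x y : nonneg_vec x -> rnorm y < 1 ->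
  (forall k, x ord0 k <= y ord0 k) -> M x <= M y.
Proof.
move=> x0 yB xy; have y0 : nonneg_vec y by move=> k; exact: le_trans (x0 k) (xy k).
apply: max_modulus_le => // z zx; apply: le_max_modulus_polydisc => // k.
by rewrite zx.
Qed.

(** * Controlling all derivatives by the maximum modulus *)

Lemma fact_le_exp (N k : nat) : (k <= N)%N -> (k`! <= N ^ k)%N.
Proof.
by elim: k => [//|k IH] kN; rewrite factS expnS leq_mul// IH// ltnW.
Qed.

Lemma mfact_le N (J : 'I_n -> nat) : (0 < N)%N -> (mdeg J <= N)%N ->
  (mfact J <= N ^ N)%N.
Proof.
move=> N0 JN; apply: (@leq_trans (N ^ mdeg J)%N); last by rewrite leq_pexp2l.
rewrite /mfact /mdeg expn_sum; apply: leq_prod => k _.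
by apply: fact_le_exp; exact: leq_trans (le_mdeg J k) JN.
Qed.

(** Decreasing the radii only keeps the points in the polydisc of [x], where the
    maximum principle bounds [F]. *)
Definition inward_box x theta (tau : R) y := forall k,
  y ord0 k <= x ord0 k /\ x ord0 k - y ord0 k <= tau / L k (polar x theta).

Lemma inward_box_ball rho tau x theta y : (forall k, rho <= x ord0 k) ->
  rnorm x < 1 -> 0 <= tau <= rho -> inward_box x theta tau y ->
  nonneg_vec y /\ rnorm y < 1.
Proof.
move=> xr xB /andP[tau0 taur] yx.
have y0 : nonneg_vec y.
  move=> k; have [_ d] := yx k.
  have L1 : 1 <= L k (polar x theta) by apply: L_ge1; rewrite unit_ball_polar.
  have le : tau / L k (polar x theta) <= tau.
    by rewrite ler_pdivrMr ?ler_peMr// (lt_le_trans ltr01).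
  by have := xr k; move: d le taur; lra.
split=> //; apply: le_lt_trans xB; apply: rnorm_le => k.
have [yk _] := yx k; rewrite !ger0_norm//; exact: le_trans (y0 k) yk.
Qed.

Lemma inward_box_comparable x theta tau y j : rnorm x < 1 -> tau <= 1 ->
  inward_box x theta tau y ->
  L j (polar y theta) <= Lam * L j (polar x theta).
Proof.
move=> xB tau1 yx.
have xU : unit_ball (polar x theta) by rewrite unit_ball_polar.
suff H : forall k, cabs (polar y theta ord0 k - polar x theta ord0 k)
    <= 1 / L k (polar x theta) by case: (L_comp.2 _ _ j xU H).
move=> k; have [yk d] := yx k.
rewrite cabs_polarB distrC ger0_norm ?subr_ge0//; apply: le_trans d _.
by rewrite ler_pM2r// invr_gt0 (lt_le_trans ltr01)// L_ge1.
Qed.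

(** A point of the box is reached by [n] radial steps, one for each coordinate,
    so [gmax] grows by a constant factor only; bounded index then covers the
    order [m + 1] as well. *)
Lemma box_derivatives rho : 0 < rho -> exists tau0 D, [/\ 0 < tau0 <= rho, 0 <= D &
  forall x theta y (J : 'I_n -> nat), (forall k, rho <= x ord0 k) -> rnorm x < 1 ->
    inward_box x theta tau0 y -> (mdeg J <= m.+1)%N ->
    cabs (mderiv J F (polar y theta)) <=
      D * gm (polar x theta) * mpow (fun k => L k (polar x theta)) J].
Proof.
move=> rho0.
have [eps [CS [eps0 eps1 CS1 step]]] := radial_step aF L_ge1 L_comp index_m.
have Lam1 := Lam_ge1 L_comp; have Lam0 : 0 < Lam := lt_le_trans ltr01 Lam1.
pose tau0 := Num.min rho (eps / Lam).
have tau00 : 0 < tau0 by rewrite lt_min rho0 divr_gt0.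
have taur : tau0 <= rho by rewrite ge_min lexx.
have taue : tau0 <= eps / Lam by rewrite ge_min lexx orbT.
have tau1 : tau0 <= 1.
  by apply: le_trans taue _; rewrite ler_pdivrMr// mul1r (le_trans eps1).
pose N := (m.+1 ^ m.+1)%N.
exists tau0, (CS ^+ n * (N%:R * Lam ^+ m.+1)); split.
- by rewrite tau00.
- by rewrite !mulr_ge0// exprn_ge0// ?(ltW Lam0)// (le_trans ler01).
move=> x theta y J xr xB yx Jm.
have box z : inward_box x theta tau0 z -> nonneg_vec z /\ rnorm z < 1.
  by apply: (inward_box_ball xr xB); rewrite (ltW tau00).
pose w (i : nat) : 'rV[R]_n := \row_k (if (k < i)%N then y ord0 k else x ord0 k).
have xU : unit_ball (polar x theta) by rewrite unit_ball_polar.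
have wbox i : inward_box x theta tau0 (w i).
  move=> k; rewrite mxE; case: ifP => _; first exact: yx.
  by rewrite lexx subrr divr_ge0 ?(ltW tau00)// (le_trans ler01)// L_ge1.
have grow i : (i <= n)%N -> gm (polar (w i) theta) <= CS ^+ i * gm (polar x theta).
  elim: i => [_|i IH ni].
    by have -> : w 0%N = x; [apply/rowP => k; rewrite mxE|rewrite expr0 mul1r].
  pose j := Ordinal ni.
  have wS : w i.+1 = upd (w i) j (y ord0 j).
    apply/rowP => k; rewrite !mxE ltnS leq_eqVlt.
    have [->|kj] := eqVneq k j; first by rewrite /= eqxx.
    by rewrite -(inj_eq val_inj) /= in kj; rewrite (negbTE kj).
  have wj : w i ord0 j = x ord0 j by rewrite mxE /= ltnn.
  have [w0 wB] := box _ (wbox i).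
  have [w0' wB'] := box _ (wbox i.+1).
  have y0 := (box _ yx).1.
  rewrite exprS -mulrA wS; apply: le_trans (_ : CS * gm (polar (w i) theta) <= _).
    apply: step => //; first by rewrite -wS.
    rewrite wj; have [yj d] := yx j.
    rewrite distrC ger0_norm ?subr_ge0//; apply: le_trans d _.
    have Lw : L j (polar (w i) theta) <= Lam * L j (polar x theta).
      exact: inward_box_comparable xB tau1 (wbox i).
    have Lw0 : 0 < L j (polar (w i) theta).
      by rewrite (lt_le_trans ltr01)// L_ge1// unit_ball_polar.
    have Lx0 : 0 < L j (polar x theta) by rewrite (lt_le_trans ltr01)// L_ge1.
    apply: (@le_trans _ _ (eps / Lam / L j (polar x theta))).
      by rewrite ler_pM2r ?invr_gt0.
    by rewrite -mulrA ler_pM2l// -invfM lef_pV2 ?posrE ?mulr_gt0.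
  by rewrite ler_wpM2l ?(le_trans ler01)// IH// ltnW.
have wn : w n = y by apply/rowP => k; rewrite mxE ltn_ord.
have gy : gm (polar y theta) <= CS ^+ n * gm (polar x theta) by rewrite -wn; exact: grow.
have yU : unit_ball (polar y theta) by rewrite unit_ball_polar; case: (box _ yx).
apply: le_trans (cabs_mderiv_le L_ge1 index_m J yU) _.
rewrite -[leRHS]mulrA [leRHS](_ : _ = (CS ^+ n * gm (polar x theta)) *
    (N%:R * (Lam ^+ m.+1 * mpow (fun k => L k (polar x theta)) J))); last first.
  by move: (CS ^+ n) (Lam ^+ m.+1) (gm _) (mpow _ _) N%:R => *; ring.
apply: ler_pM => //; first exact: gmax_ge0.
  by rewrite ltW// mulr_gt0 ?ltr0n ?mfact_gt0// prodr_gt0// => k _;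
    rewrite exprn_gt0// (lt_le_trans ltr01)// L_ge1.
apply: ler_pM => //.
- by apply: prodr_ge0 => k _; rewrite exprn_ge0// (le_trans ler01)// L_ge1.
- by rewrite ler_nat mfact_le.
apply: mpow_le => // k; first by rewrite (le_trans ler01)// L_ge1.
exact: inward_box_comparable xB tau1 yx.
Qed.

(** Landau's inequality along inward radial segments, applied order by order:
    the error term uses derivatives two orders up, which bounded index ties back
    to [gmax], with a factor as small as the segment is short.  All segments
    point inwards, so that only values of [F] inside the polydisc occur. *)
Lemma landau_orders rho tau0 D : 0 < tau0 <= rho -> 0 <= D ->
  (forall x theta y (J : 'I_n -> nat), (forall k, rho <= x ord0 k) -> rnorm x < 1 ->
    inward_box x theta tau0 y -> (mdeg J <= m.+1)%N ->
    cabs (mderiv J F (polar y theta)) <=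
      D * gm (polar x theta) * mpow (fun k => L k (polar x theta)) J) ->
  forall p, (p <= m)%N -> forall eta, 0 < eta -> exists2 A, 0 <= A &
    forall x theta y (J : 'I_n -> nat), (forall k, rho <= x ord0 k) -> rnorm x < 1 ->
      inward_box x theta (tau0 / 2 ^+ p) y -> mdeg J = p ->
      cabs (mderiv J F (polar y theta)) <= (eta * gm (polar x theta) + A * M x)
         * mpow (fun k => L k (polar x theta)) J.
Proof.
move=> /andP[tau00 taur] D0 HD.
have x0_of x : (forall k, rho <= x ord0 k) -> nonneg_vec x.
  by move=> xr k; apply: le_trans (xr k); apply: le_trans taur; exact: ltW.
elim=> [_|p IH pm] eta eta0.
  exists 1 => // x theta y J xr xB; rewrite expr0 divr1 => yx J0.
  have JE : J = fun=> 0%N.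
    by apply: funext => k; apply/eqP; rewrite -leqn0 -J0 le_mdeg.
  have [y0 yB] : nonneg_vec y /\ rnorm y < 1.
    by apply: (inward_box_ball xr xB _ yx); rewrite (ltW tau00).
  rewrite JE mderiv0 /mpow big1 // mulr1 mul1r.
  apply: (@le_trans _ _ (M x)); last by rewrite lerDr mulr_ge0 ?(ltW eta0)// gmax_ge0.
  apply: le_max_modulus_polydisc => // [|k]; first exact: x0_of.
  by rewrite cabs_polar ger0_norm//; case: (yx k).
have p0 : 0 < 2 ^+ p :> R by rewrite exprn_gt0.
(* the step: small enough for the error term to take at most half of eta *)
pose tau := Num.min (tau0 / 2 ^+ p.+1) (eta / (8 * D + 1)).
have D1 : 0 < 8 * D + 1 by lra.
have tpos : 0 < tau by rewrite lt_min !divr_gt0// exprn_gt0.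
have t1 : tau <= tau0 / 2 ^+ p.+1 by rewrite ge_min lexx.
have t2 : tau * (8 * D + 1) <= eta by rewrite -ler_pdivlMr// ge_min lexx orbT.
have half : tau0 / 2 ^+ p.+1 + tau0 / 2 ^+ p.+1 = tau0 / 2 ^+ p.
  by rewrite exprS invfM; move: ((2 ^+ p)^-1) => q; field.
have eta'0 : 0 < eta * tau / 4 by rewrite !(mulr_gt0, divr_gt0).
have [A' A'0 HA] := IH (ltnW pm) _ eta'0.
exists (2 * A' / tau); first by rewrite divr_ge0 ?mulr_ge0// ltW.
move=> x theta y J xr xB yx Jp.
have [k Jk] : exists k, J k != 0%N.
  apply: contrapT => H; move: Jp; rewrite /mdeg big1// => k _.
  by apply/eqP/negPn/negP => Jk; apply: H; exists k.
pose J' : 'I_n -> nat := fun i => (J i - (i == k))%N.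
have JE : J = addone J' k.
  apply: funext => i; rewrite /addone /J'; case: eqP => [->|_].
    by rewrite subnK// lt0n.
  by rewrite subn0 addn0.
have J'p : mdeg J' = p by move: Jp; rewrite JE mdeg_addone => -[].
have xU : unit_ball (polar x theta) by rewrite unit_ball_polar.
set l := L k (polar x theta).
have l1 : 1 <= l by exact: L_ge1.
have l0 : 0 < l := lt_le_trans ltr01 l1.
pose s := - (tau / l).
have tl0 : 0 <= tau / l by apply: divr_ge0; exact: ltW.
have sn : `|s| = tau / l by rewrite normrN ger0_norm.
pose yu u := upd y k (y ord0 k + u * s).
have yu0 : yu 0 = y by rewrite /yu mul0r addr0 upd_id.
have box u : u \in `[0, 1]%R -> inward_box x theta (tau0 / 2 ^+ p) (yu u).
  rewrite in_itv/= => /andP[u0 u1] i; rewrite updE.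
  have le2 : tau0 / 2 ^+ p.+1 <= tau0 / 2 ^+ p.
    by rewrite -half lerDl ltW// divr_gt0// exprn_gt0.
  have Li0 : 0 < (L i (polar x theta))^-1.
    by rewrite invr_gt0 (lt_le_trans ltr01)// L_ge1.
  case: eqP => [->|_]; last first.
    by have [? d] := yx i; split=> //; apply: le_trans d _; rewrite ler_pM2r.
  have [yk d] := yx k; rewrite -half mulrDl -/l in d *.
  have us : 0 <= u * (tau / l) <= tau / l.
    by rewrite mulr_ge0//= ler_piMl.
  have tl : tau / l <= tau0 / 2 ^+ p.+1 / l by rewrite ler_pM2r ?invr_gt0.
  by rewrite /s mulrN; move: us d tl yk; clear; lra.
have box0 u : u \in `[0, 1]%R -> inward_box x theta tau0 (yu u).
  move=> /box H i; have [? d] := H i; split => //; apply: le_trans d _.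
  rewrite ler_pM2r ?invr_gt0; last by rewrite (lt_le_trans ltr01)// L_ge1.
  by rewrite ler_pdivrMr// ler_peMr ?(ltW tau00)// exprn_ege1// ler1n.
have yuB u : u \in `[0, 1]%R -> rnorm (yu u) < 1.
  move=> /box0 H; have : 0 <= tau0 <= rho by rewrite (ltW tau00).
  by move=> t; case: (inward_box_ball xr xB t H).
have yuU u : u \in `[0, 1]%R -> unit_ball (polar (yu u) theta).
  by move=> /yuB; rewrite unit_ball_polar.
pose a : Cplx R := s%:C * direction theta k.
have ca : cabs a = tau / l by rewrite cabsM cabs_direction mulr1 cabs_real.
pose f u := mderiv J' F (polar (yu u) theta).
pose f1 u := a * mderiv J F (polar (yu u) theta).
pose f2 u := a * (a * mderiv (addone J k) F (polar (yu u) theta)).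
have df u : u \in `[0, 1]%R -> cderiv f u (f1 u).
  move=> u01; have := @radial_cderiv R n (mderiv J' F) y theta k (y ord0 k) s u
    (analytic_mderiv J' aF) (yuB u u01).
  by rewrite (pderiv_mderiv J' k aF (yuU u u01)) -JE.
have df1 u : u \in `[0, 1]%R -> cderiv f1 u (f2 u).
  move=> u01; apply: cderiv_scale.
  have := @radial_cderiv R n (mderiv J F) y theta k (y ord0 k) s u
    (analytic_mderiv J aF) (yuB u u01).
  by rewrite (pderiv_mderiv J k aF (yuU u u01)).
set g := gm (polar x theta) in HA HD *.
set P := mpow (fun k => L k (polar x theta)) J'.
have PJ : mpow (fun k => L k (polar x theta)) J = l * P by rewrite JE mpow_addone.
have P0 : 0 < P.
  by apply: prodr_gt0 => i _; rewrite exprn_gt0// (lt_le_trans ltr01)// L_ge1.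
have g0 : 0 <= g by exact: gmax_ge0.
have f2B u : u \in `[0, 1]%R -> cabs (f2 u) <= tau ^+ 2 * (D * g * P).
  move=> u01; rewrite /f2 (cabsM a) (cabsM a) ca.
  have := HD x theta (yu u) (addone J k) xr xB (box0 u u01).
  rewrite mdeg_addone Jp => /(_ pm); rewrite mpow_addone PJ -/l -/g => H.
  apply: le_trans (ler_wpM2l tl0 (ler_wpM2l tl0 H)) _.
  by rewrite le_eqVlt; apply/orP; left; apply/eqP; field; rewrite gt_eqF.
have i0 : (0 : R) \in `[0, 1]%R by rewrite in_itv/= lexx ler01.
have i1 : (1 : R) \in `[0, 1]%R by rewrite in_itv/= lexx ler01.
have lan := landau_inequality df df1 f2B.
have b0 := HA x theta (yu 0) J' xr xB (box 0 i0) J'p.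
have b1 := HA x theta (yu 1) J' xr xB (box 1 i1) J'p.
rewrite -/P -/g in b0 b1.
rewrite PJ; move: lan; rewrite {1}/f1 (cabsM a) ca yu0 => lan.
set X := cabs (mderiv J F (polar y theta)) in lan *.
have lan2 : tau / l * X <=
    2 * ((eta * tau / 4 * g + A' * M x) * P) + 4 * (tau ^+ 2 * (D * g * P)).
  by apply: le_trans lan _; rewrite lerD2r mulr_natl mulr2n; apply: lerD.
have tX : tau * X <= l * P * (tau * eta * g + 2 * A' * M x).
  have -> : tau * X = l * (tau / l * X) by field; rewrite gt_eqF.
  apply: le_trans (ler_wpM2l (ltW l0) lan2) _; rewrite -[leRHS]mulrA ler_pM2l//.
  have h1 : 4 * (tau * D) <= eta / 2 by lra.
  have : 4 * (tau * D) * (tau * g * P) <= eta / 2 * (tau * g * P).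
    by rewrite ler_wpM2r// !mulr_ge0// ltW.
  by move: (M x) => *; lra.
rewrite -(ler_pM2l tpos); apply: le_trans tX _.
by rewrite le_eqVlt; apply/orP; left; apply/eqP; field; rewrite gt_eqF.
Qed.

(** Together with [cabs_le_gmax] this makes [gmax] and [|F|] interchangeable on
    tori, where the maximum principle is available for [|F|] only. *)
Lemma gmax_le_max_modulus rho : 0 < rho -> exists2 A, 0 <= A &
  forall x theta, (forall k, rho <= x ord0 k) -> rnorm x < 1 ->
    gm (polar x theta) <= A * M x.
Proof.
move=> rho0; have [tau0 [D [tau0r D0 HD]]] := box_derivatives rho0.
have half0 : 0 < 2^-1 :> R by rewrite invr_gt0.
have /choice[A HA] : forall p : 'I_m.+1, exists A, 0 <= A /\
    forall x theta y (J : 'I_n -> nat), (forall k, rho <= x ord0 k) -> rnorm x < 1 ->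
      inward_box x theta (tau0 / 2 ^+ p) y -> mdeg J = p ->
      cabs (mderiv J F (polar y theta)) <= (2^-1 * gm (polar x theta) + A * M x)
         * mpow (fun k => L k (polar x theta)) J.
  move=> p; have pm : (p <= m)%N by rewrite -ltnS.
  by have [A ? ?] := landau_orders tau0r D0 HD pm half0; exists A.
pose B := \big[Num.max/0]_p A p.
have B0 : 0 <= B by exact: bigmax_ge_id.
exists (2 * B); first by rewrite mulr_ge0.
move=> x theta xr xB.
have x0 : nonneg_vec x by move=> k; exact: le_trans (ltW rho0) (xr k).
have M0 := max_modulus_ge0 x0 xB.
have xU : unit_ball (polar x theta) by rewrite unit_ball_polar.
suff : gm (polar x theta) <= 2^-1 * gm (polar x theta) + B * M x by lra.
have g0 : 0 <= gm (polar x theta) by exact: gmax_ge0.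
have R0 : 0 <= 2^-1 * gm (polar x theta) + B * M x.
  by rewrite addr_ge0// mulr_ge0// ltW.
apply: gmax_le => // K Km; rewrite /norm_deriv ler_pdivrMr; last first.
  exact: deriv_weight_gt0.
pose p : 'I_m.+1 := Ordinal (Km : (mdeg K < m.+1)%N).
have [A0 Ap] := HA p.
have box : inward_box x theta (tau0 / 2 ^+ p) x.
  move=> k; rewrite lexx subrr; split => //; rewrite divr_ge0 ?divr_ge0 ?exprn_ge0//.
    by case/andP: tau0r => /ltW.
  by rewrite (le_trans ler01)// L_ge1.
have W0 : 0 <= mpow (fun k => L k (polar x theta)) K.
  by apply: prodr_ge0 => k _; rewrite exprn_ge0// (le_trans ler01)// L_ge1.
apply: le_trans (Ap x theta x K xr xB box erefl) _.
apply: ler_pM => //.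
- by rewrite addr_ge0// mulr_ge0// ltW.
- by rewrite lerD2l ler_wpM2r//; exact: le_bigmax.
- by rewrite ler_peMl// ler1n mfact_gt0.
Qed.

(** [path_growth] for [|F|] in place of [gmax], passing through [gmax] and back. *)
Lemma max_modulus_stage rho : 0 < rho -> exists A C, [/\ 0 <= A, 1 <= C &
  forall y j b theta, (forall k, rho <= y ord0 k) -> y ord0 j <= b ->
    rnorm (upd y j b) < 1 -> angles theta ->
    M (upd y j b) <= C * expR (A * \int[lebesgue_measure]_(t in `[y ord0 j, b])
                  L j (polar (upd y j t) theta)) * M y].
Proof.
move=> rho0; have [A [C [A0 C1 path]]] := path_growth.
have [B B0 HB] := gmax_le_max_modulus rho0.
exists A, (C * (B + 1)); split => //; first by rewrite mulr_ege1// lerDr.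
move=> y j b theta yr yb bB th.
have y0 : nonneg_vec y by move=> k; exact: le_trans (ltW rho0) (yr k).
have yB : rnorm y < 1.
  rewrite -(upd_id y j); apply: (@rnorm_upd_lt1 R n y j (y ord0 j) b) => //.
  by rewrite lexx.
apply: max_modulus_le => [|z zb].
  by apply: nonneg_upd => //; exact: le_trans (y0 j) yb.
have [phi ph ->] := torus_polar zb.
apply: le_trans (_ : gm (polar (upd y j b) phi) <= _).
  by apply: (cabs_le_gmax L_ge1 index_m); rewrite unit_ball_polar.
apply: le_trans (path y j b theta phi y0 yb bB th ph) _.
set E := expR _.
have E0 : 0 <= E by exact: expR_ge0.
have My := max_modulus_ge0 y0 yB.
have C0 : 0 <= C by lra.
have gB : gm (polar y phi) <= (B + 1) * M y.
  by apply: le_trans (HB y phi yr yB) _; rewrite ler_wpM2r// lerDl.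
apply: le_trans (ler_wpM2l (mulr_ge0 C0 E0) gB) _.
by rewrite le_eqVlt; apply/orP; left; apply/eqP; ring.
Qed.

(** * The path from r to r0 *)

Definition stage_radii r0 r (sigma : {perm 'I_n}) (i : nat) : 'rV[R]_n :=
  \row_k (if (sigma k < i)%N then r0 ord0 k else r ord0 k).

Lemma radii_stage r0 r j (sigma : {perm 'I_n}) t :
  radii r0 r j sigma t = upd (stage_radii r0 r sigma (sigma j)) j t.
Proof.
apply/rowP => k; rewrite !mxE.
by have [->|kj] := eqVneq k j; rewrite ?ltnn.
Qed.

Lemma stage_radiiS r0 r j (sigma : {perm 'I_n}) :
  stage_radii r0 r sigma (sigma j).+1 =
  upd (stage_radii r0 r sigma (sigma j)) j (r0 ord0 j).
Proof.
apply/rowP => k; rewrite !mxE ltnS leq_eqVlt.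
have [->|kj] := eqVneq k j; first by rewrite eqxx.
have /negbTE -> // : (sigma k : nat) != sigma j.
by rewrite (inj_eq val_inj) (inj_eq perm_inj).
Qed.

Lemma stage_radii_id r0 r j (sigma : {perm 'I_n}) :
  upd (stage_radii r0 r sigma (sigma j)) j (r ord0 j) = stage_radii r0 r sigma (sigma j).
Proof.
by apply/rowP => k; rewrite !mxE; case: eqP => // ->; rewrite ltnn.
Qed.

Local Notation leg r0 r sigma theta j :=
  (\int[lebesgue_measure]_(t in `[0, r ord0 j])
     L j (polar (radii r0 r j sigma t) theta)).

Lemma leg_continuous r0 r sigma theta j : admissible r0 r ->
  continuous_on_itv (fun t => L j (polar (radii r0 r j sigma t) theta)) 0 (r ord0 j).
Proof.
move=> adm t; rewrite in_itv/= => tr.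
have -> : (fun t => L j (polar (radii r0 r j sigma t) theta)) =
    (fun t => L j (polar (upd (stage_radii r0 r sigma (sigma j)) j t) theta)).
  by apply: funext => u; rewrite radii_stage.
by apply: L_path_continuous; rewrite -radii_stage; exact: adm.
Qed.

Lemma leg_ge r0 r sigma theta j : nonneg_vec r -> admissible r0 r ->
  r ord0 j <= leg r0 r sigma theta j.
Proof.
move=> r_ge0 adm.
have := integral_ge_cst (k := 1) (r_ge0 j) (@leg_continuous r0 r sigma theta j adm).
rewrite subr0 mul1r; apply => t; rewrite in_itv/= => tr.
by apply: L_ge1; rewrite unit_ball_polar; exact: adm.
Qed.

Lemma path_integral_ge r0 r sigma theta j : nonneg_vec r -> admissible r0 r ->
  r ord0 j <= path_integral L r0 r sigma theta.
Proof.
move=> r_ge0 adm; rewrite /path_integral (bigD1 j)//=.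
apply: ler_wpDr; last exact: leg_ge.
by apply: sumr_ge0 => k _; apply: le_trans (r_ge0 k) _; exact: leg_ge.
Qed.

Lemma stage_radii_ball r0 r (sigma : {perm 'I_n}) i : nonneg_vec r ->
  rnorm r0 < 1 -> admissible r0 r -> rnorm (stage_radii r0 r sigma i) < 1.
Proof.
move=> r_ge0 r0B adm; have [ni|ni] := leqP n i.
  suff -> : stage_radii r0 r sigma i = r0 by [].
  by apply/rowP => k; rewrite mxE (leq_trans (ltn_ord _) ni).
pose j := (sigma^-1)%g (Ordinal ni).
have sj : sigma j = i :> nat by rewrite /j permKV.
rewrite -sj -stage_radii_id -radii_stage; apply: adm.
by rewrite r_ge0 lexx.
Qed.

(** The coordinates are brought from [r] to [r0] in the order [sigma].  A
    coordinate with [r_j < r0_j] has to grow, which only increases the maximum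
    modulus. *)
Lemma max_modulus_path rho : 0 < rho -> exists A C, [/\ 0 <= A, 1 <= C &
  forall r0 r sigma theta, (forall k, rho <= r0 ord0 k) ->
    (forall k, rho <= r ord0 k) -> rnorm r0 < 1 -> admissible r0 r ->
    angles theta ->
    M r <= C * expR (A * path_integral L r0 r sigma theta) * M r0].
Proof.
move=> rho0; have [A [C [A0 C1 stage]]] := max_modulus_stage rho0.
exists A, (C ^+ n); split=> //; first exact: exprn_ege1.
move=> r0 r sigma theta r0r rr r0B adm th.
have C0 : 0 < C := lt_le_trans ltr01 C1.
have r_ge0 : nonneg_vec r by move=> k; exact: le_trans (ltW rho0) (rr k).
pose y := stage_radii r0 r sigma.
have yr i k : rho <= y i ord0 k by rewrite mxE; case: ifP.
have y_ge0 i : nonneg_vec (y i) by move=> k; exact: le_trans (ltW rho0) (yr i k).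
have yB i : rnorm (y i) < 1 by exact: stage_radii_ball.
have leg0 j : 0 <= leg r0 r sigma theta j.
  by apply: le_trans (r_ge0 j) _; exact: leg_ge.
have step j : M (y (sigma j)) <=
    C * expR (A * leg r0 r sigma theta j) * M (y (sigma j).+1).
  have yS : y (sigma j).+1 = upd (y (sigma j)) j (r0 ord0 j) by exact: stage_radiiS.
  have yid : upd (y (sigma j)) j (r ord0 j) = y (sigma j) by exact: stage_radii_id.
  have E1 : 1 <= expR (A * leg r0 r sigma theta j).
    by rewrite -[leLHS](@expR0 R) ler_expR mulr_ge0.
  have yM i : 0 <= M (y i) by exact: max_modulus_ge0.
  have [le|lt] := leP (r0 ord0 j) (r ord0 j); last first.
    apply: le_trans (_ : M (y (sigma j).+1) <= _).
      apply: max_modulus_mono => // k; rewrite yS updE.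
      by case: eqP => // ->; rewrite mxE ltnn ltW.
    by rewrite ler_peMl// mulr_ege1.
  have updy t : upd (y (sigma j).+1) j t = radii r0 r j sigma t.
    by rewrite yS upd_upd radii_stage.
  have yj : y (sigma j).+1 ord0 j = r0 ord0 j by rewrite mxE ltnSn.
  have bB : rnorm (upd (y (sigma j).+1) j (r ord0 j)) < 1.
    by rewrite yS upd_upd yid.
  have := stage (y (sigma j).+1) j (r ord0 j) theta (yr _).
  rewrite yj => /(_ le bB th); rewrite {1}yS upd_upd yid => H.
  apply: le_trans H _; rewrite ler_wpM2r// ler_wpM2l ?(ltW C0)// ler_expR ler_wpM2l//.
  have -> : (fun t => L j (polar (upd (y (sigma j).+1) j t) theta)) =
      (fun t => L j (polar (radii r0 r j sigma t) theta)).
    by apply: funext => t; rewrite updy.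
  have cl := @leg_continuous r0 r sigma theta j adm.
  have r0j : 0 <= r0 ord0 j by exact: le_trans (ltW rho0) (r0r j).
  rewrite (integral_split r0j le cl) lerDr.
  have cl0 := continuous_on_sub (lexx 0) le cl.
  have := integral_ge_cst (k := 0) r0j cl0; rewrite mul0r; apply => t.
  rewrite in_itv/= => /andP[t0 tr0]; rewrite (le_trans ler01)// L_ge1//.
  by rewrite unit_ball_polar; apply: adm; rewrite t0 (le_trans tr0 le).
have chain (i : nat) : (i <= n)%N -> M r <= C ^+ i *
    expR (A * \sum_(j | (sigma j < i)%N) leg r0 r sigma theta j) * M (y i).
  elim: i => [_|i IH ni].
    rewrite big1 ?mulr0 ?expR0 ?expr0 ?mul1r//.
    by have -> : y 0%N = r by apply/rowP => k; rewrite mxE.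
  pose j := (sigma^-1)%g (Ordinal ni).
  have sj : sigma j = i :> nat by rewrite /j permKV.
  rewrite (bigD1 j)/=; last by rewrite sj.
  have -> : \sum_(k | (sigma k < i.+1)%N && (k != j)) leg r0 r sigma theta k =
      \sum_(k | (sigma k < i)%N) leg r0 r sigma theta k.
    apply: eq_bigl => k; rewrite ltnS leq_eqVlt -sj (inj_eq val_inj) (inj_eq perm_inj).
    by have [->|] := eqVneq k j; rewrite ?ltnn ?andbF ?andbT.
  have := step j; rewrite sj => st.
  rewrite mulrDr expRD exprS; apply: le_trans (IH (ltnW ni)) _.
  have K0 : 0 <= C ^+ i * expR (A * \sum_(k | (sigma k < i)%N) leg r0 r sigma theta k).
    by rewrite mulr_ge0 ?expR_ge0// exprn_ge0// ltW.
  apply: le_trans (ler_wpM2l K0 st) _.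
  by rewrite le_eqVlt; apply/orP; left; apply/eqP; ring.
have := chain n (leqnn n).
have -> : y n = r0 by apply/rowP => k; rewrite mxE ltn_ord.
suff -> : \sum_(j | (sigma j < n)%N) leg r0 r sigma theta j =
    path_integral L r0 r sigma theta by [].
by apply: eq_bigl => j; rewrite ltn_ord.
Qed.

End Paths.

(** * Admissible radii close to the boundary *)

Section Admissible.
Variables (R : realType) (n : nat).
Implicit Types (r x : 'rV[R]_n).

Lemma rnorm_sqr x : rnorm x ^+ 2 = \sum_k x ord0 k ^+ 2.
Proof. by rewrite sqr_sqrtr// sumr_ge0// => k _; exact: sqr_ge0. Qed.

Lemma rnorm_ge0 x : 0 <= rnorm x.
Proof. exact: sqrtr_ge0. Qed.

Lemma coord_le_rnorm x k : x ord0 k <= rnorm x.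
Proof.
apply: le_trans (ler_norm _) _; rewrite -sqrtr_sqr ler_wsqrtr// (bigD1 k)//=.
by rewrite lerDl sumr_ge0// => *; exact: sqr_ge0.
Qed.

Lemma pos_lower_bound (I : finType) (f : I -> R) : (forall i, 0 < f i) ->
  exists2 d, 0 < d & forall i, d <= f i.
Proof.
move=> f0; exists (\big[Num.min/1]_i f i); first exact: lt_bigmin.
by move=> i; exact: bigmin_le.
Qed.

(** Replacing the single coordinate [r_k] by [r0_k] must keep the point in the
    ball; if [|r|] is close to 1 this leaves [r_k] little room below [r0_k]. *)
Lemma admissible_lower_bound r0 r (delta : R) : (forall k, 0 < r0 ord0 k) ->
  rnorm r0 < 1 -> (forall k, delta <= r0 ord0 k ^+ 2 / 4) ->
  nonneg_vec r -> 1 - delta < rnorm r < 1 -> admissible r0 r ->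
  forall k, r0 ord0 k / 2 <= r ord0 k.
Proof.
move=> r0pos r0B dr r_ge0 /andP[rd rB] adm k.
have r0k := r0pos k; have rk := r_ge0 k.
have r0k1 : r0 ord0 k < 1 := le_lt_trans (coord_le_rnorm r0 k) r0B.
have dk := dr k.
have d4 : delta <= 4^-1 by nra.
rewrite leNgt; apply/negP => small.
have [n1|n1] := leqP n 1.
  (* in dimension one r_k is the norm of r itself *)
  have only_k i : i = k.
    apply: val_inj => /=; have := ltn_ord i; have := ltn_ord k.
    by move: (i : nat) (k : nat) n1 => a b; case: n => [|[|]] //; case: a; case: b.
  have : rnorm r = r ord0 k.
    rewrite /rnorm (bigD1 k)//= big1 ?addr0 ?sqrtr_sqr ?ger0_norm// => i.
    by rewrite (only_k i) eqxx.
  by move=> E; move: rd; rewrite E; lra.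
have n0 : (0 < n)%N by exact: ltnW.
(* sigma treats k first, and the leg j comes second: its endpoint is r with
   r_k alone replaced by r0_k *)
pose i0 : 'I_n := Ordinal n0; pose i1 : 'I_n := Ordinal n1.
pose sigma : {perm 'I_n} := tperm k i0.
pose j := (sigma^-1)%g i1.
have sj : sigma j = i1 by rewrite /j permKV.
have sk : sigma k = i0 by rewrite /sigma tpermL.
have adj := adm sigma j (r ord0 j); rewrite lexx r_ge0 in adj.
have {adj} lt1 := adj isT.
have sq : rnorm (radii r0 r j sigma (r ord0 j)) ^+ 2 < 1.
  by rewrite -[ltRHS](expr1n _ 2) ltrXn2r ?nnegrE ?rnorm_ge0.
have rsq : (1 - delta) ^+ 2 < rnorm r ^+ 2.
  by rewrite ltrXn2r ?nnegrE ?rnorm_ge0//; lra.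
rewrite !rnorm_sqr in sq rsq.
rewrite (bigD1 k)//= in sq; rewrite (bigD1 k)//= in rsq.
have rest : \sum_(i | i != k) radii r0 r j sigma (r ord0 j) ord0 i ^+ 2 =
    \sum_(i | i != k) r ord0 i ^+ 2.
  apply: eq_bigr => i ik; rewrite mxE sj /= ltnS leqn0.
  have /negbTE -> : (sigma i : nat) != 0%N.
    by rewrite -[0%N]/(i0 : nat) -sk (inj_eq val_inj) (inj_eq perm_inj).
  by case: eqP => // ->.
rewrite rest mxE sj sk /= in sq.
move: (\sum_(i | i != k) r ord0 i ^+ 2) sq rsq => S sq rsq.
have : r ord0 k ^+ 2 <= r0 ord0 k ^+ 2 / 4 by nra.
by move: sq rsq; nra.
Qed.

End Admissible.

(** * The growth estimate *)

Lemma le_growth_bound (R : realType) (n : nat) (L : 'I_n -> 'rV[Cplx R]_n -> R)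
    (r0 r : 'rV[R]_n) (x : R) :
  (forall sigma theta, angles theta -> x <= path_integral L r0 r sigma theta) ->
  x <= growth_bound L r0 r.
Proof.
move=> H; apply: lb_le_inf.
  exists (inf [set path_integral L r0 r 1%g theta | theta in @angles R n]).
  by exists 1%g.
move=> _ [sigma _ <-]; apply: lb_le_inf.
  by exists (path_integral L r0 r sigma 0), 0 => //; exact: angles0.
by move=> _ [theta th <-]; exact: H.
Qed.

Theorem theorem14 (R : realType) (n : nat) (hn : (0 < n)%N)
    (beta c : R) (hbeta : Num.sqrt n%:R < beta)
    (L : 'I_n -> 'rV[Cplx R]_n -> R)
    (hQ : class_Q beta L) (hK : class_K beta c L)
    (hc : c * Num.sqrt n%:R < beta)
    (F : 'rV[Cplx R]_n -> Cplx R)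
    (hF : analytic_on_ball F) (hind : bounded_L_index L F)
    (r0 : 'rV[R]_n) (hr0 : forall j, 0 < r0 ord0 j) (hr0ball : rnorm r0 < 1) :
  exists C delta : R, [/\ 0 < C, 0 < delta &
    forall r : 'rV[R]_n, nonneg_vec r -> 1 - delta < rnorm r < 1 ->
      admissible r0 r ->
      `| ln (max_modulus F r) | <= C * growth_bound L r0 r].
Proof.
have [m index_m] := hind.
have L_ge1 := class_Q_ge1 hbeta hQ.
have [Lam L_comp] := class_Q_comparable hbeta hQ.
have L_cont : forall j (z : 'rV[Cplx R]_n), unit_ball z -> {for z, continuous (L j)}.
  by case: hQ.
have c_ge1 : 1 <= c by case: hK.
have L_torus r theta1 theta2 j : nonneg_vec r -> rnorm r < 1 ->
    angles theta1 -> angles theta2 ->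
    L j (polar r theta2) <= c * L j (polar r theta1).
  exact: class_K_torus hK r theta1 theta2 j.
pose j0 : 'I_n := Ordinal hn.
have [rho rho0 rho_le] : exists2 rho, 0 < rho & forall k, rho <= r0 ord0 k / 2.
  by apply: pos_lower_bound => k; rewrite divr_gt0.
have [delta delta0 delta_le] : exists2 delta, 0 < delta &
    forall k, delta <= r0 ord0 k ^+ 2 / 4.
  by apply: pos_lower_bound => k; rewrite divr_gt0// exprn_gt0.
have [A [C [A0 C1 path]]] :=
  max_modulus_path hF L_ge1 L_comp index_m L_cont c_ge1 L_torus rho0.
have mono := max_modulus_mono hF L_ge1 L_comp index_m L_cont c_ge1 L_torus.
have M_ge0 := max_modulus_ge0 hF L_ge1 L_comp index_m L_cont c_ge1 L_torus.
(* admissible radii near the boundary dominate h = r0 / 2; hence M(F, h) bounds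
   M(F, r) from below, and the path from r0 to h compares it with M(F, r0) *)
pose h : 'rV[R]_n := \row_k (r0 ord0 k / 2).
have hE k : h ord0 k = r0 ord0 k / 2 by rewrite mxE.
have h_rho k : rho <= h ord0 k by rewrite hE.
have h_ge0 : nonneg_vec h by move=> k; exact: le_trans (ltW rho0) (h_rho k).
have r0_ge0 : nonneg_vec r0 by move=> k; exact: ltW.
have hle k : h ord0 k <= r0 ord0 k by rewrite hE; have := hr0 k; lra.
have r0_rho k : rho <= r0 ord0 k by exact: le_trans (h_rho k) (hle k).
have hB : rnorm h < 1.
  by apply: le_lt_trans hr0ball; apply: rnorm_le => k; rewrite !ger0_norm.
have adm_h : admissible h r0.
  move=> sigma j t /andP[t0 tr]; apply: le_lt_trans hr0ball; apply: rnorm_le => k.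
  rewrite mxE; case: ifP => _; first by rewrite !ger0_norm.
  by case: eqP => // ->; rewrite !ger0_norm//; exact: le_trans tr.
have low := path h r0 1%g 0 h_rho r0_rho hB adm_h (@angles0 R n).
set C2 := C * expR _ in low.
have C20 : 0 < C2 by rewrite mulr_gt0 ?expR_gt0// (lt_le_trans ltr01).
have good r : nonneg_vec r -> 1 - delta < rnorm r < 1 -> admissible r0 r ->
    forall k, h ord0 k <= r ord0 k.
  move=> r_ge0 rd adm k; rewrite hE.
  exact: admissible_lower_bound hr0 hr0ball delta_le r_ge0 rd adm k.
suff [B B0 HB] : exists2 B, 0 < B & forall r, nonneg_vec r ->
    1 - delta < rnorm r < 1 -> admissible r0 r -> forall sigma theta, angles theta ->
    `| ln (max_modulus F r) | <= B * path_integral L r0 r sigma theta.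
  exists B, delta; split => // r r_ge0 rd adm; rewrite mulrC -ler_pdivrMr//.
  apply: le_growth_bound => sigma theta th; rewrite ler_pdivrMr// mulrC.
  exact: HB.
have up r sigma theta : nonneg_vec r -> 1 - delta < rnorm r < 1 -> admissible r0 r ->
    angles theta -> max_modulus F r <=
    C * expR (A * path_integral L r0 r sigma theta) * max_modulus F r0.
  move=> r_ge0 rd adm th; apply: path => // k.
  exact: le_trans (h_rho k) (good r r_ge0 rd adm k).
have pge r sigma theta : nonneg_vec r -> 1 - delta < rnorm r < 1 -> admissible r0 r ->
    rho <= path_integral L r0 r sigma theta.
  move=> r_ge0 rd adm.
  apply: le_trans (path_integral_ge L_ge1 L_cont sigma theta j0 r_ge0 adm).
  exact: le_trans (h_rho j0) (good r r_ge0 rd adm j0).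
(* if F vanishes on the torus of radii r0, it does so on the torus of r, and
   ln 0 = 0 *)
have [M0|M0] := eqVneq (max_modulus F r0) 0.
  exists 1 => // r r_ge0 rd adm sigma theta th.
  have := up r sigma theta r_ge0 rd adm th; rewrite M0 mulr0 => Mr.
  rewrite ln0// normr0 mul1r; apply: le_trans (pge r sigma theta r_ge0 rd adm).
  exact: ltW.
have {}M0 : 0 < max_modulus F r0 by rewrite lt_neqAle eq_sym M0 M_ge0.
pose mu := max_modulus F r0 / C2.
have mu0 : 0 < mu by rewrite divr_gt0.
(* the additive constants are absorbed, as the path integral is at least rho *)
pose K := ln C + `|ln (max_modulus F r0)| + `|ln mu|.
have K0 : 0 <= K by rewrite !addr_ge0// ln_ge0.
exists (A + K / rho + 1); first by rewrite ltr_wpDl// addr_ge0// divr_ge0// ltW.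
move=> r r_ge0 rd adm sigma theta th.
have P_rho := pge r sigma theta r_ge0 rd adm.
have Mup := up r sigma theta r_ge0 rd adm th.
have Mlow : mu <= max_modulus F r.
  apply: (@le_trans _ _ (max_modulus F h)).
    by rewrite /mu ler_pdivrMr// mulrC.
  by apply: mono => // [|k]; [case/andP: rd|exact: good].
have Mr : 0 < max_modulus F r := lt_le_trans mu0 Mlow.
set P := path_integral L r0 r sigma theta in P_rho Mup *.
have P0 : 0 <= P by exact: le_trans (ltW rho0) P_rho.
have KP : K <= K / rho * P.
  by rewrite -mulrA ler_peMr// mulrC ler_pdivlMr// mul1r.
have C0 : 0 < C := lt_le_trans ltr01 C1.
have lnup : ln (max_modulus F r) <= ln C + A * P + ln (max_modulus F r0).
  have <- : ln (C * expR (A * P) * max_modulus F r0) =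
      ln C + A * P + ln (max_modulus F r0).
    by rewrite !lnM ?posrE ?mulr_gt0 ?expR_gt0// expRK.
  by rewrite ler_ln ?posrE// ?mulr_gt0 ?expR_gt0.
have lnlow : ln mu <= ln (max_modulus F r) by rewrite ler_ln ?posrE.
have AP : 0 <= A * P by rewrite mulr_ge0.
have a1 := ler_norm (ln (max_modulus F r0)).
have a2 := ler_norm (- ln mu); rewrite normrN in a2.
have lnC : 0 <= ln C by rewrite ln_ge0.
have n1 := normr_ge0 (ln (max_modulus F r0)); have n2 := normr_ge0 (ln mu).
rewrite !mulrDl mul1r; rewrite ler_norml; apply/andP.
by rewrite /K in KP *; split; lra.
Qed.
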